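(* Let $X$ be an irreducible $n$-variety. There is a natural embedding of $k$-algebras $$\psi_X\colon k_n(X)\hookrightarrow\operatorname{RMaps}_{\operatorname{PGL}_n}(X,\operatorname{M}_n)$$ (sending an element of $k_n(X)$ to the rational map $X\dashrightarrow\operatorname{M}_n$ it defines), allowing us to identify $k_n(X)$ with a $k$-subalgebra of $\operatorname{RMaps}_{\operatorname{PGL}_n}(X,\operatorname{M}_n)$. The algebra $\operatorname{RMaps}_{\operatorname{PGL}_n}(X,\operatorname{M}_n)$ is a central simple algebra of degree $n$, whose center can be identified with $k(X)^{\operatorname{PGL}_n}$. Moreover, $k(X)^{\operatorname{PGL}_n}$ is a finite, purely inseparable extension of the center of $k_n(X)$, and $$\operatorname{RMaps}_{\operatorname{PGL}_n}(X,\operatorname{M}_n)=k_n(X)\cdot k(X)^{\operatorname{PGL}_n}.$$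
   Context: $k$ is an algebraically closed field of arbitrary characteristic and $n\ge 1$ is a fixed integer. (In characteristic zero ''purely inseparable'' means that the extension is trivial.) All rings and algebras are associative with $1$; subrings and homomorphisms respect $1$. $\operatorname{M}_n$ is the algebra of $n\times n$ matrices over $k$; $\operatorname{PGL}_n$ acts on $\operatorname{M}_n$ by conjugation and on $(\operatorname{M}_n)^m$ by simultaneous conjugation. $U_{m,n}\subseteq(\operatorname{M}_n)^m$ is the $\operatorname{PGL}_n$-stable Zariski open set of $m$-tuples that generate $\operatorname{M}_n$ as a $k$-algebra. An $n$-variety is a $\operatorname{PGL}_n$-stable subset $X$ of some $U_{m,n}$ that is Zariski closed in $U_{m,n}$. The generic matrix ring $G_{m,n}=k\{X_1,\dots,X_m\}$ is the $k$-subalgebra of $\operatorname{M}_n(k[x_{i,j}^{(h)}])$ generated by the generic matrices $X_h=(x_{i,j}^{(h)})_{i,j}$, $1\le h\le m$; its elements can be evaluated at points of $(\operatorname{M}_n)^m$. For an $n$-variety $X\subseteq U_{m,n}$, $\mathcal I(X)=\{p\in G_{m,n}\mid p(a)=0\ \forall a\in X\}$ and $k_n[X]=G_{m,n}/\mathcal I(X)$, whose elements are viewed as $\operatorname{PGL}_n$-equivariant functions $X\to\operatorname{M}_n$. For irreducible $X$, $k_n[X]$ is a prime PI-algebra of PI-degree $n$, and $k_n(X)$ denotes its total ring of fractions, a central simple algebra of degree $n$. Every element of $k_n(X)$ has the form $pc^{-1}$ with $p,c\in k_n[X]$ and $c$ central and nonzero; $c$ takes scalar values, nonzero on a dense open subset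 of $X$, so $pc^{-1}$ defines the $\operatorname{PGL}_n$-equivariant rational map $x\mapsto p(x)c(x)^{-1}$. $\operatorname{RMaps}_{\operatorname{PGL}_n}(X,\operatorname{M}_n)$ is the $k$-algebra of $\operatorname{PGL}_n$-equivariant rational maps $X\dashrightarrow\operatorname{M}_n$. $k(X)^{\operatorname{PGL}_n}$ is the field of $\operatorname{PGL}_n$-invariant rational functions on $X$, identified with the equivariant rational maps $X\dashrightarrow k\cdot I_n\subseteq\operatorname{M}_n$, where $I_n$ is the identity matrix. *)

(* Defs.v *)
From HB Require Import structures.
From mathcomp Require Import all_boot all_order all_algebra all_field.
From mathcomp Require Import generic_quotient ring_quotient.
From mathcomp Require Import boolp classical_sets.
From mathcomp Require Import mpoly.

Set Implicit Arguments.
Unset Strict Implicit.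
Unset Printing Implicit Defensive.

Import GRing.Theory.
Local Open Scope ring_scope.
Local Open Scope quotient_scope.
Local Open Scope classical_set_scope.

(* The ring quotients of ring_quotient are restricted to commutative rings. *)
Section TwoSidedQuotient.
Variables (k : fieldType) (A : algType k).

Record twoSidedIdeal := TwoSidedIdeal {
  left_ideal :> idealr A;
  idealrMl : forall a u : A, u \in left_ideal -> u * a \in left_ideal }.

Variable I : twoSidedIdeal.

Definition algQuot : Type := Quotient.quot I.
HB.instance Definition _ := GRing.Zmodule.on algQuot.
HB.instance Definition _ := ZmodQuotient.on algQuot.

Definition aq_one : algQuot := lift_cst algQuot 1.
Definition aq_mul := lift_op2 algQuot *%R.
Definition aq_scale (c : k) := lift_op1 algQuot ( *:%R c).

Canonical aq_pi_one_morph := PiConst aq_one.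

Lemma aq_pi_mul : {morph \pi : x y / x * y >-> aq_mul x y}.
Proof.
move=> x y; unlock aq_mul; apply/eqP; rewrite piE Quotient.equivE.
rewrite -[_ * _](addrNK (x * repr (\pi_algQuot y))) -mulrBr.
rewrite -addrA -mulrBl rpredD //.
  by rewrite idealMr // Quotient.idealrDE opprK reprK.
by rewrite idealrMl // Quotient.idealrDE opprK reprK.
Qed.
Canonical aq_pi_mul_morph := PiMorph2 aq_pi_mul.

Lemma aq_pi_scale c : {morph \pi : x / c *: x >-> aq_scale c x}.
Proof.
move=> x; unlock aq_scale; apply/eqP; rewrite piE Quotient.equivE.
by rewrite -scalerBr -mulr_algl idealMr // Quotient.idealrDE opprK reprK.
Qed.
Canonical aq_pi_scale_morph c := PiMorph1 (aq_pi_scale c).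

Lemma aq_mulA : associative aq_mul.
Proof. by move=> x y z; rewrite -[x]reprK -[y]reprK -[z]reprK !piE mulrA. Qed.
Lemma aq_mul1 : left_id aq_one aq_mul.
Proof. by move=> x; rewrite -[x]reprK !piE mul1r. Qed.
Lemma aq_mulr1 : right_id aq_one aq_mul.
Proof. by move=> x; rewrite -[x]reprK !piE mulr1. Qed.
Lemma aq_mulDl : left_distributive aq_mul +%R.
Proof.
move=> x y z; rewrite -[x]reprK -[y]reprK -[z]reprK.
by rewrite !piE mulrDl.
Qed.
Lemma aq_mulDr : right_distributive aq_mul +%R.
Proof.
move=> x y z; rewrite -[x]reprK -[y]reprK -[z]reprK.
by rewrite !piE mulrDr.
Qed.
Lemma aq_one_neq0 : aq_one != 0.
Proof. by rewrite piE Quotient.equivE subr0 idealr1. Qed.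

HB.instance Definition _ := GRing.Zmodule_isNzRing.Build algQuot
  aq_mulA aq_mul1 aq_mulr1 aq_mulDl aq_mulDr aq_one_neq0.

Lemma aq_scaleA a b (v : algQuot) :
  aq_scale a (aq_scale b v) = aq_scale (a * b) v.
Proof. by rewrite -[v]reprK !piE scalerA. Qed.
Lemma aq_scale1 : left_id 1 aq_scale.
Proof. by move=> v; rewrite -[v]reprK !piE scale1r. Qed.
Lemma aq_scaleDr : right_distributive aq_scale +%R.
Proof.
move=> c x y; rewrite -[x]reprK -[y]reprK.
by rewrite !piE scalerDr.
Qed.
Lemma aq_scaleDl v : {morph aq_scale^~ v : a b / a + b}.
Proof.
move=> a b; rewrite -[v]reprK.
by rewrite !piE scalerDl.
Qed.
HB.instance Definition _ := GRing.Zmodule_isLmodule.Build k algQuot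
  aq_scaleA aq_scale1 aq_scaleDr aq_scaleDl.

Lemma aq_scaleAl (c : k) (u v : algQuot) : c *: (u * v) = (c *: u) * v.
Proof.
rewrite -[u]reprK -[v]reprK -[LHS]/(aq_scale c (aq_mul _ _)).
by rewrite -[RHS]/(aq_mul (aq_scale _ _) _) !piE scalerAl.
Qed.
HB.instance Definition _ := GRing.Lmodule_isLalgebra.Build k algQuot aq_scaleAl.

Lemma aq_scaleAr (c : k) (u v : algQuot) : c *: (u * v) = u * (c *: v).
Proof.
rewrite -[u]reprK -[v]reprK -[LHS]/(aq_scale c (aq_mul _ _)).
by rewrite -[RHS]/(aq_mul _ (aq_scale _ _)) !piE scalerAr.
Qed.
HB.instance Definition _ := GRing.Lalgebra_isAlgebra.Build k algQuot aq_scaleAr.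

End TwoSidedQuotient.

Section RingNotions.

Definition center (A : nzRingType) : set A := [set z | forall a, z * a = a * z].

Definition regular_elt (A : nzRingType) (s : A) : Prop :=
  forall a, (s * a = 0 -> a = 0) /\ (a * s = 0 -> a = 0).

(* Q, with the map iota : R -> Q, is the total ring of fractions of R: every
   regular element of R becomes invertible and every q in Q is of the form
   iota a * (iota s)^-1 with s regular. *)
Definition total_ring_of_fractions (R Q : nzRingType) (iota : R -> Q) : Prop :=
  [/\ injective iota,
      forall s, regular_elt s -> exists t, iota s * t = 1 /\ t * iota s = 1
    & forall q, exists a s t,
        [/\ regular_elt s, iota s * t = 1, t * iota s = 1 & q = iota a * t]].

Definition simple_ring (A : nzRingType) : Prop :=
  forall J : set A, J 0 -> (forall x y, J x -> J y -> J (x + y)) ->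
    (forall a x, J x -> J (a * x) /\ J (x * a)) ->
    J = [set 0] \/ J = setT.

Definition central_simple_of_degree (d : nat) (A : nzRingType) : Prop :=
  simple_ring A /\
  exists b : 'I_(d ^ 2) -> A, forall a : A,
    exists! z : {ffun 'I_(d ^ 2) -> A},
      (forall i, @center A (z i)) /\ a = \sum_i z i * b i.

Definition subfield (A : nzRingType) (K : set A) : Prop :=
  [/\ K 1, forall x y, K x -> K y -> K (x - y),
      forall x y, K x -> K y -> K (x * y) /\ x * y = y * x
    & forall x, K x -> x != 0 -> exists2 y, K y & x * y = 1].

Definition finite_extension (A : nzRingType) (K L : set A) : Prop :=
  exists d (b : 'I_d -> A), (forall i, L (b i)) /\
    forall x, L x -> exists z : 'I_d -> A,
      (forall i, K (z i)) /\ x = \sum_i z i * b i.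

(* If the characteristic is p > 0, then [pchar A].-nat N says that N is a power
   of p; in characteristic zero it says that N = 1. *)
Definition purely_inseparable_extension (A : nzRingType) (K L : set A) : Prop :=
  forall x, L x -> exists2 N : nat, [pchar A].-nat N & K (x ^+ N).

Definition finite_purely_inseparable (A : nzRingType) (K L : set A) : Prop :=
  [/\ subfield K, subfield L, K `<=` L, finite_extension K L
    & purely_inseparable_extension K L].

End RingNotions.

(* Matrices have size n.+1, i.e., the degree ranges over all integers >= 1. *)
Section Varieties.
Variables (k : closedFieldType) (m n : nat).

Definition point := 'I_m -> 'M[k]_n.+1.

Definition coordIndex := ('I_m * 'I_n.+1 * 'I_n.+1)%type.
Definition coordPoly := {mpoly k[#|{: coordIndex}|]}.

Definition coordVar (h : 'I_m) (i j : 'I_n.+1) : coordPoly :=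
  'X_(enum_rank ((h, i, j) : coordIndex)).

Definition coords (a : point) (v : 'I_#|{: coordIndex}|) : k :=
  let: (h, i, j) := enum_val v in a h i j.

Definition peval (a : point) (p : coordPoly) : k := p.@[coords a].
HB.instance Definition _ a :=
  GRing.RMorphism.copy (peval a) (meval (coords a)).

Definition zclosed (Z : set point) : Prop :=
  exists S : set coordPoly, Z = [set a | forall p, S p -> peval a p = 0].

Definition open_in (X U : set point) : Prop :=
  exists2 Z, zclosed Z & U = X `\` Z.

Definition dense_open (X U : set point) : Prop :=
  open_in X U /\ forall W, open_in X W -> W !=set0 -> (U `&` W) !=set0.

Definition irreducible_set (X : set point) : Prop :=
  X !=set0 /\ forall Z1 Z2, zclosed Z1 -> zclosed Z2 ->
    X `<=` Z1 `|` Z2 -> X `<=` Z1 \/ X `<=` Z2.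

(* The action of PGL_n, written as an action of the invertible matrices. *)
Definition tconj (g : 'M[k]_n.+1) (a : point) : point :=
  fun h => g * a h * invmx g.

Definition genTuples : set point :=
  [set a | agenv <<[seq a h | h <- enum 'I_m]>> = fullv]%VS.

Definition n_variety (X : set point) : Prop :=
  [/\ X `<=` genTuples,
      exists2 Z, zclosed Z & X = genTuples `&` Z
    & forall g a, g \in unitmx -> X a -> X (tconj g a)].

Record irrNVariety := IrrNVariety {
  nvar_set :> set point;
  nvar_n_variety : n_variety nvar_set;
  nvar_irreducible : irreducible_set nvar_set }.

(* Matrices over the polynomial ring, as an algebra over k. *)
Definition polyMx := 'M[coordPoly]_n.+1.
HB.instance Definition _ := GRing.NzRing.on polyMx.

Definition polyMx_scale (c : k) (M : polyMx) : polyMx :=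
  (c%:MP : coordPoly) *: (M : 'M[coordPoly]_n.+1).

Lemma polyMx_scaleA a b M :
  polyMx_scale a (polyMx_scale b M) = polyMx_scale (a * b) M.
Proof. by rewrite /polyMx_scale scalerA mpolyCM. Qed.
Lemma polyMx_scale1 : left_id 1 polyMx_scale.
Proof. by move=> M; rewrite /polyMx_scale mpolyC1 scale1r. Qed.
Lemma polyMx_scaleDr : right_distributive polyMx_scale +%R.
Proof. by move=> c M N; apply: scalerDr. Qed.
Lemma polyMx_scaleDl M : {morph polyMx_scale^~ M : a b / a + b}.
Proof. by move=> a b; rewrite /polyMx_scale mpolyCD scalerDl. Qed.
HB.instance Definition _ := GRing.Zmodule_isLmodule.Build k polyMx
  polyMx_scaleA polyMx_scale1 polyMx_scaleDr polyMx_scaleDl.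
Lemma polyMx_scaleAl (c : k) (M N : polyMx) : c *: (M * N) = (c *: M) * N.
Proof. exact: scalerAl. Qed.
HB.instance Definition _ :=
  GRing.Lmodule_isLalgebra.Build k polyMx polyMx_scaleAl.
Lemma polyMx_scaleAr (c : k) (M N : polyMx) : c *: (M * N) = M * (c *: N).
Proof. exact: scalerAr. Qed.
HB.instance Definition _ :=
  GRing.Lalgebra_isAlgebra.Build k polyMx polyMx_scaleAr.

Definition genericMx (h : 'I_m) : polyMx := \matrix_(i, j) coordVar h i j.

Definition in_genericRing (p : polyMx) : bool :=
  `[< forall S : {pred polyMx}, GRing.subalg_closed S ->
        (forall h, genericMx h \in S) -> p \in S >].

Lemma in_genericRing_subalg : GRing.subalg_closed in_genericRing.
Proof.
split.
- by apply/asboolP => S [].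
- move=> c p q /asboolP Hp /asboolP Hq; apply/asboolP => S HS Hgen.
  by have [_ Hlin _] := HS; apply: Hlin; [apply: Hp | apply: Hq].
- move=> p q /asboolP Hp /asboolP Hq; apply/asboolP => S HS Hgen.
  by have [_ _ Hmul] := HS; apply: Hmul; [apply: Hp | apply: Hq].
Qed.
HB.instance Definition _ :=
  GRing.isSubalgClosed.Build k polyMx in_genericRing in_genericRing_subalg.

Record genericRing := GenericRing {
  gr_val : polyMx; gr_valP : in_genericRing gr_val }.
HB.instance Definition _ := [isSub for gr_val].
HB.instance Definition _ := [Choice of genericRing by <:].
HB.instance Definition _ := [SubChoice_isSubAlgebra of genericRing by <:].

Definition gr_eval (a : point) (p : genericRing) : 'M[k]_n.+1 :=
  map_mx (peval a) (gr_val p).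

Lemma gr_eval_zmod a : zmod_morphism (gr_eval a).
Proof. by move=> p q; exact: (map_mxB (peval a)). Qed.
HB.instance Definition _ a :=
  GRing.isZmodMorphism.Build genericRing 'M[k]_n.+1 (gr_eval a) (gr_eval_zmod a).
Lemma gr_eval_monoid a : monoid_morphism (gr_eval a).
Proof.
split; first exact: (map_mx1 (peval a)).
by move=> p q; exact: (map_mxM (peval a)).
Qed.
HB.instance Definition _ a := GRing.isMonoidMorphism.Build
  genericRing 'M[k]_n.+1 (gr_eval a) (gr_eval_monoid a).

Section CoordinateRing.
Variable X : irrNVariety.

Definition in_idealOf (p : genericRing) : bool :=
  `[< forall a, nvar_set X a -> gr_eval a p = 0 >].

Lemma in_idealOf_closed : idealr_closed in_idealOf.
Proof.
split.
- by apply/asboolP => a _; rewrite raddf0.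
- apply/asboolPn => H; have [[a Xa] _] := nvar_irreducible X.
  by move/eqP: (H a Xa); rewrite rmorph1 oner_eq0.
- move=> c p q /asboolP Hp /asboolP Hq; apply/asboolP => a Xa.
  by rewrite rmorphD rmorphM /= Hp // Hq // mulr0 addr0.
Qed.
HB.instance Definition _ :=
  isIdealr.Build genericRing in_idealOf in_idealOf_closed.

Lemma in_idealOfMl (c p : genericRing) : in_idealOf p -> in_idealOf (p * c).
Proof.
move=> /asboolP Hp; apply/asboolP => a Xa.
by rewrite rmorphM /= Hp // mul0r.
Qed.

Definition idealOf : twoSidedIdeal genericRing :=
  @TwoSidedIdeal k genericRing in_idealOf in_idealOfMl.

(* k_n[X] *)
Definition coordRing : Type := algQuot idealOf.
HB.instance Definition _ := GRing.Algebra.on coordRing.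

(* For a in X the value does not depend on the representative. *)
Definition cr_eval (a : point) (p : coordRing) : 'M[k]_n.+1 :=
  gr_eval a (repr (p : algQuot idealOf)).

Lemma cr_eval_pi a p : nvar_set X a ->
  cr_eval a (\pi_(algQuot idealOf) p) = gr_eval a p.
Proof.
move=> Xa; apply/eqP; rewrite -subr_eq0 -rmorphB; apply/eqP.
suff: in_idealOf (repr (\pi_(algQuot idealOf) p) - p) by move/asboolP; exact.
have /eqP := reprK (\pi_(algQuot idealOf) p).
by rewrite piE Quotient.equivE.
Qed.

End CoordinateRing.

Section RationalMaps.

Definition regular_fun (X U : set point) (f : point -> k) : Prop :=
  forall a, U a -> exists W P Q,
    [/\ open_in X W, W a &
        forall b, U b -> W b -> peval b Q != 0 /\ f b = peval b P / peval b Q].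

(* A map to a finite-dimensional vector space (an affine space) is regular if
   its composite with each linear functional is; for matrices this amounts to
   the regularity of all the entries. *)
Definition regular_map (V : falgType k) (X U : set point) (f : point -> V) :=
  forall l : {scalar V}, regular_fun X U (fun a => l (f a)).

(* A finite-dimensional k-algebra on which the invertible matrices act by
   algebra automorphisms. *)
Record matAlgebra := MatAlgebra {
  ma_alg :> falgType k;
  ma_act : 'M[k]_n.+1 -> ma_alg -> ma_alg;
  ma_act1 : forall g, g \in unitmx -> ma_act g 1 = 1;
  ma_actP : forall g (c : k) u v, g \in unitmx ->
    ma_act g (c *: u + v) = c *: ma_act g u + ma_act g v;
  ma_actM : forall g u v, g \in unitmx ->
    ma_act g (u * v) = ma_act g u * ma_act g v }.

Lemma conjmx1 (g : 'M[k]_n.+1) : g \in unitmx -> g * 1 * invmx g = 1.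
Proof. by move=> gU; rewrite mulr1; apply: mulmxV. Qed.
Lemma conjmxP (g : 'M[k]_n.+1) (c : k) u v : g \in unitmx ->
  g * (c *: u + v) * invmx g = c *: (g * u * invmx g) + g * v * invmx g.
Proof. by move=> _; rewrite mulrDr mulrDl -scalerAr -scalerAl. Qed.
Lemma conjmxM (g u v : 'M[k]_n.+1) : g \in unitmx ->
  g * (u * v) * invmx g = (g * u * invmx g) * (g * v * invmx g).
Proof.
move=> gU; have gK : invmx g * g = 1 by apply: mulVmx.
by rewrite !mulrA -[_ * invmx g * g]mulrA gK mulr1.
Qed.

Definition conjMx : matAlgebra := @MatAlgebra 'M[k]_n.+1
  (fun g u => g * u * invmx g) conjmx1 conjmxP conjmxM.

Definition trivScalars : matAlgebra := @MatAlgebra k^o (fun _ u => u)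
  (fun _ _ => erefl) (fun _ _ _ _ _ => erefl) (fun _ _ _ _ => erefl).

Variables (X : irrNVariety) (V : matAlgebra).

Definition pointFun := point -> V.
HB.instance Definition _ := gen_eqMixin pointFun.
HB.instance Definition _ := gen_choiceMixin pointFun.

Definition pf_add (f g : pointFun) : pointFun := fun a => f a + g a.
Definition pf_opp (f : pointFun) : pointFun := fun a => - f a.
Definition pf_mul (f g : pointFun) : pointFun := fun a => f a * g a.
Definition pf_scale (c : k) (f : pointFun) : pointFun := fun a => c *: f a.

Local Ltac pf_tac lem := repeat intro; apply: (@funext point V) => ?; apply: lem.

Lemma pf_addA : associative pf_add. Proof. pf_tac addrA. Qed.
Lemma pf_addC : commutative pf_add. Proof. pf_tac addrC. Qed.
Lemma pf_add0 : left_id (fun=> 0) pf_add. Proof. pf_tac add0r. Qed.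
Lemma pf_addN : left_inverse (fun=> 0) pf_opp pf_add. Proof. pf_tac addNr. Qed.
HB.instance Definition _ :=
  GRing.isZmodule.Build pointFun pf_addA pf_addC pf_add0 pf_addN.

Lemma pf_mulA : associative pf_mul. Proof. pf_tac mulrA. Qed.
Lemma pf_mul1 : left_id (fun=> 1) pf_mul. Proof. pf_tac mul1r. Qed.
Lemma pf_mulr1 : right_id (fun=> 1) pf_mul. Proof. pf_tac mulr1. Qed.
Lemma pf_mulDl : left_distributive pf_mul pf_add. Proof. pf_tac mulrDl. Qed.
Lemma pf_mulDr : right_distributive pf_mul pf_add. Proof. pf_tac mulrDr. Qed.
Lemma pf_one_neq0 : ((fun=> 1) : pointFun) != 0.
Proof.
by apply/eqP => /(congr1 (@^~ (fun=> 0))) /eqP; rewrite oner_eq0.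
Qed.
HB.instance Definition _ := GRing.Zmodule_isNzRing.Build pointFun
  pf_mulA pf_mul1 pf_mulr1 pf_mulDl pf_mulDr pf_one_neq0.

Lemma pf_scaleA a b f : pf_scale a (pf_scale b f) = pf_scale (a * b) f.
Proof. pf_tac scalerA. Qed.
Lemma pf_scale1 : left_id 1 pf_scale. Proof. pf_tac scale1r. Qed.
Lemma pf_scaleDr : right_distributive pf_scale +%R. Proof. pf_tac scalerDr. Qed.
Lemma pf_scaleDl f : {morph pf_scale^~ f : a b / a + b}.
Proof. pf_tac scalerDl. Qed.
HB.instance Definition _ := GRing.Zmodule_isLmodule.Build k pointFun
  pf_scaleA pf_scale1 pf_scaleDr pf_scaleDl.
Lemma pf_scaleAl (c : k) (f g : pointFun) : c *: (f * g) = (c *: f) * g.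
Proof. pf_tac @scalerAl. Qed.
HB.instance Definition _ := GRing.Lmodule_isLalgebra.Build k pointFun pf_scaleAl.
Lemma pf_scaleAr (c : k) (f g : pointFun) : c *: (f * g) = f * (c *: g).
Proof. pf_tac @scalerAr. Qed.
HB.instance Definition _ :=
  GRing.Lalgebra_isAlgebra.Build k pointFun pf_scaleAr.

(* f is regular and equivariant on a dense open subset of X; its values outside
   of this subset are irrelevant. *)
Definition equivariant_rational (f : pointFun) : bool :=
  `[< exists U, [/\ dense_open X U, regular_map X U f &
        forall g a, g \in unitmx -> U a -> U (tconj g a) ->
          f (tconj g a) = ma_act g (f a)] >].

Definition generically_zero (f : pointFun) : bool :=
  `[< exists2 U, dense_open X U & forall a, U a -> f a = 0 >].

Lemma zclosedU Z1 Z2 : zclosed Z1 -> zclosed Z2 -> zclosed (Z1 `|` Z2).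
Proof.
move=> [S1 ->] [S2 ->].
exists [set p | exists p1 p2, [/\ S1 p1, S2 p2 & p = p1 * p2]].
apply/seteqP; split => a /=.
  by move=> [H|H] _ [p1 [p2 [h1 h2 ->]]]; rewrite rmorphM /=;
    [rewrite (H _ h1) mul0r | rewrite (H _ h2) mulr0].
move=> H; have [H1|] := pselect (forall p, S1 p -> peval a p = 0); first by left.
move=> /existsNP [p1 /not_implyP [s1 n1]]; right => p2 s2.
have : peval a (p1 * p2) = 0 by apply: H; exists p1, p2.
rewrite rmorphM /= => /eqP; rewrite mulf_eq0.
by case/orP => /eqP.
Qed.

Lemma open_inI Y U W : open_in Y U -> open_in Y W -> open_in Y (U `&` W).
Proof.
move=> [Z1 c1 ->] [Z2 c2 ->]; exists (Z1 `|` Z2); first exact: zclosedU.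
apply/seteqP; split => a /=; first by move=> [[? ?] [_ ?]]; split=> // -[].
by move=> [? H]; split; split=> // ?; apply: H; [left|right].
Qed.

Lemma dense_openI Y U W :
  dense_open Y U -> dense_open Y W -> dense_open Y (U `&` W).
Proof.
move=> [oU dU] [oW dW]; split; first exact: open_inI.
by move=> O oO O0; rewrite -setIA; apply: dU; [apply: open_inI | apply: dW].
Qed.

Lemma open_inT Y : open_in Y Y.
Proof.
exists set0; last by rewrite setD0.
exists setT; apply/seteqP; split=> // a /(_ 1 I) /eqP.
by rewrite /peval rmorph1 oner_eq0.
Qed.

Lemma dense_openT Y : dense_open Y Y.
Proof.
split=> [|W [Z _ ->] [a []]]; first exact: open_inT.
by exists a.
Qed.

Lemma regular_funW Y U W f : W `<=` U -> regular_fun Y U f -> regular_fun Y W f.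
Proof.
move=> WU Hf a /WU /Hf [O [P [Q [? ? H]]]]; exists O, P, Q; split=> // b /WU.
exact: H.
Qed.

Lemma regular_fun_cst Y U c : U `<=` Y -> regular_fun Y U (fun=> c).
Proof.
move=> UY a Ua; exists Y, c%:MP, 1; split; [exact: open_inT | exact: UY |].
move=> b _ _; rewrite /peval rmorph1 oner_eq0; split=> //.
by rewrite /= mevalC divr1.
Qed.

Lemma regular_funD Y U f g : regular_fun Y U f -> regular_fun Y U g ->
  regular_fun Y U (fun a => f a + g a).
Proof.
move=> Hf Hg a Ua.
have [W1 [P1 [Q1 [o1 w1 H1]]]] := Hf _ Ua.
have [W2 [P2 [Q2 [o2 w2 H2]]]] := Hg _ Ua.
exists (W1 `&` W2), (P1 * Q2 + P2 * Q1), (Q1 * Q2).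
split=> //; first exact: open_inI.
move=> b Ub [/(H1 _ Ub) [n1 e1] /(H2 _ Ub) [n2 e2]].
move: n1 n2 e1 e2; rewrite /peval !rmorphD /= !rmorphM /= => n1 n2 -> ->.
by split; [rewrite mulf_neq0 | rewrite addf_div].
Qed.

Lemma regular_funM Y U f g : regular_fun Y U f -> regular_fun Y U g ->
  regular_fun Y U (fun a => f a * g a).
Proof.
move=> Hf Hg a Ua.
have [W1 [P1 [Q1 [o1 w1 H1]]]] := Hf _ Ua.
have [W2 [P2 [Q2 [o2 w2 H2]]]] := Hg _ Ua.
exists (W1 `&` W2), (P1 * P2), (Q1 * Q2).
split=> //; first exact: open_inI.
move=> b Ub [/(H1 _ Ub) [n1 e1] /(H2 _ Ub) [n2 e2]].
move: n1 n2 e1 e2; rewrite /peval !rmorphM /= => n1 n2 -> ->.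
by split; [rewrite mulf_neq0 | rewrite mulf_div].
Qed.

Lemma regular_fun_sum (T : Type) (s : seq T) Y U (F : T -> point -> k) :
  U `<=` Y -> (forall t, regular_fun Y U (F t)) ->
  regular_fun Y U (fun a => \sum_(t <- s) F t a).
Proof.
move=> UY HF; elim: s => [|t s IH].
  by under eq_fun do rewrite big_nil; apply: regular_fun_cst.
by under eq_fun do rewrite big_cons; apply: regular_funD.
Qed.

Lemma open_in_sub Y U : open_in Y U -> U `<=` Y.
Proof. by move=> [Z _ ->] a []. Qed.

Lemma regular_mapW (f : pointFun) Y U W :
  W `<=` U -> regular_map Y U f -> regular_map Y W f.
Proof. by move=> WU Hf l; apply: regular_funW (Hf l). Qed.

Lemma regular_mapM (f g : pointFun) Y U : U `<=` Y ->
  regular_map Y U f -> regular_map Y U g -> regular_map Y U (f * g).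
Proof.
move=> UY Hf Hg l.
pose b := vbasis {: V}.
have bE (v : V) : v = \sum_i coord b i v *: b`_i.
  by apply: coord_vbasis; rewrite memvf.
have -> : (fun a => l ((f * g) a)) = fun a =>
    \sum_i \sum_j (coord b i (f a) * coord b j (g a)) * l (b`_i * b`_j).
  apply/funext => a; rewrite -[(f * g) a]/(f a * g a).
  rewrite {1}(bE (f a)) {1}(bE (g a)) mulr_suml linear_sum.
  apply: eq_bigr => i _; rewrite mulr_sumr linear_sum; apply: eq_bigr => j _.
  by rewrite -scalerAl -scalerAr scalerA linearZ.
apply: regular_fun_sum => // i; apply: regular_fun_sum => // j.
apply: regular_funM; last exact: regular_fun_cst.
by apply: regular_funM; [exact: (Hf (coord b i)) | exact: (Hg (coord b j))].
Qed.

Lemma equivariant_rational_subalg : GRing.subalg_closed equivariant_rational.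
Proof.
split.
- apply/asboolP; exists X; split; first exact: dense_openT.
    by move=> l; apply: (@regular_fun_cst X X (l 1)).
  by move=> g a gU _ _; rewrite ma_act1.
- move=> c f g /asboolP [U1 [d1 r1 e1]] /asboolP [U2 [d2 r2 e2]].
  apply/asboolP; exists (U1 `&` U2); split; first exact: dense_openI.
    move=> l.
    have -> : (fun a => l ((c *: f + g) a)) = fun a => c * l (f a) + l (g a).
      by apply/funext => a; rewrite -linearP.
    have sub1 : U1 `&` U2 `<=` X.
      by apply: open_in_sub; have [] := dense_openI d1 d2.
    apply: regular_funD.
      apply: regular_funM; first exact: regular_fun_cst.
      by apply: regular_funW (r1 l) => a [].
    by apply: regular_funW (r2 l) => a [].
  move=> x a gU [Ua1 Ua2] [Ug1 Ug2].
  rewrite -[RHS]/(ma_act x (c *: f a + g a)) ma_actP // -e1 // -e2 //.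
- move=> f g /asboolP [U1 [d1 r1 e1]] /asboolP [U2 [d2 r2 e2]].
  apply/asboolP; exists (U1 `&` U2); split; first exact: dense_openI.
    apply: regular_mapM.
    + by apply: open_in_sub; have [] := dense_openI d1 d2.
    + by apply: regular_mapW r1 => a [].
    + by apply: regular_mapW r2 => a [].
  move=> x a gU [Ua1 Ua2] [Ug1 Ug2].
  by rewrite -[RHS]/(ma_act x (f a * g a)) ma_actM // -e1 // -e2.
Qed.
HB.instance Definition _ := GRing.isSubalgClosed.Build k pointFun
  equivariant_rational equivariant_rational_subalg.

Record ratFun := RatFun {
  rf_val : pointFun; rf_valP : equivariant_rational rf_val }.
HB.instance Definition _ := [isSub for rf_val].
HB.instance Definition _ := [Choice of ratFun by <:].
HB.instance Definition _ := [SubChoice_isSubAlgebra of ratFun by <:].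

Definition rf_null (f : ratFun) : bool := generically_zero (rf_val f).

Lemma rf_null_closed : idealr_closed rf_null.
Proof.
split.
- by apply/asboolP; exists X; first exact: dense_openT.
- apply/asboolPn => -[U [_ dU] HU].
  have [[a Xa] _] := nvar_irreducible X.
  have [b [/HU + _]] := dU _ (open_inT X) (ex_intro _ a Xa).
  by move=> /eqP; rewrite -[_ == _]/((1 : V) == 0) oner_eq0.
- move=> c f g /asboolP [U1 d1 H1] /asboolP [U2 d2 H2].
  apply/asboolP; exists (U1 `&` U2); first exact: dense_openI.
  move=> a [/H1 e1 /H2 e2].
  rewrite -[LHS]/(rf_val c a * rf_val f a + rf_val g a).
  by rewrite e1 e2 mulr0 addr0.
Qed.
HB.instance Definition _ := isIdealr.Build ratFun rf_null rf_null_closed.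

Lemma rf_nullMl (c f : ratFun) : rf_null f -> rf_null (f * c).
Proof.
move=> /asboolP [U d H]; apply/asboolP; exists U => // a /H e.
by rewrite -[LHS]/(rf_val f a * rf_val c a) e mul0r.
Qed.

Definition rf_null_ideal : twoSidedIdeal ratFun :=
  @TwoSidedIdeal k ratFun rf_null rf_nullMl.

(* Equivariant rational maps from X to V, two of them being equal if they agree
   on a dense open subset of X. *)
Definition RMaps : Type := algQuot rf_null_ideal.
HB.instance Definition _ := GRing.Algebra.on RMaps.

Definition rm_fun (F : RMaps) : point -> V :=
  rf_val (repr (F : algQuot rf_null_ideal)).

(* F is the rational map given by f, whose domain D contains a dense open subset
   of X. *)
Definition given_by (F : RMaps) (D : set point) (f : point -> V) : Prop :=
  exists2 U, dense_open X U & forall a, U a -> D a /\ rm_fun F a = f a.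

End RationalMaps.

(* The PGL_n-equivariant rational maps from X to M_n. *)
Definition RMapsMx (X : irrNVariety) : Type := RMaps X conjMx.
HB.instance Definition _ X := GRing.Algebra.on (RMapsMx X).

(* k(X)^PGL_n *)
Definition invRatFun (X : irrNVariety) : Type := RMaps X trivScalars.
HB.instance Definition _ X := GRing.Algebra.on (invRatFun X).

End Varieties.

(* Main.v *)
Require Import Defs.
From HB Require Import structures.
From mathcomp Require Import all_boot all_order all_algebra all_field.
From mathcomp Require Import generic_quotient ring_quotient.
From mathcomp Require Import boolp classical_sets mpoly.

Set Implicit Arguments.
Unset Strict Implicit.
Unset Printing Implicit Defensive.

Import GRing.Theory.
Local Open Scope ring_scope.
Local Open Scope classical_set_scope.

(** Everything follows from one fact, [rational_descent]: every equivariant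
    rational map F from X to the matrices of size N = n + 1 is a fraction
    p / c, where p and c belong to k_n[X] and c is central and nonzero.  Such
    fractions are exactly the elements of the total ring of fractions Q, so psi
    is even an isomorphism, and the invariant functions, being the scalar
    equivariant maps, are exactly the center of Q: the purely inseparable
    extension of the statement has degree one.

    The proof of [rational_descent] is a Galois descent made explicit, and it
    takes place near one point x0 of X.  Since x0 generates the matrix algebra,
    the elements of the generic matrix ring take arbitrary values at x0.  Choose
    u with u(x0) diagonal with distinct eigenvalues, and v_1, ..., v_N such that
    the products v_i u^l form a basis at x0, hence near x0.  Writing the generic
    matrices X_h in this basis (acting from the left on the v_j), one finds: for
    an eigenvector b of u(x) with eigenvalue lambda, the matrix g with columns
    v_1(x) b, ..., v_N(x) b conjugates x into a point y(x, lambda) of X whose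
    coordinates are polynomials in lambda with central coefficients
    ([frame_split_point]).  By equivariance F(x) g = g F(y), and F(y) is a
    rational function of lambda with central coefficients; on b it therefore
    acts as an element of the ring generated by u and the center.  As this holds
    for all the eigenvectors b, which form a basis, multiplying F from the
    right by a suitable element of the ring gives an element of the ring
    ([descent]).

    That the coefficients of an element of the ring in a basis are central
    fractions ([central_expansion]) requires many central elements.  They come
    from the central polynomial of Formanek ([formanek_diag]), which yields an
    operator a |-> sum_j alpha_j a beta_j over the ring with scalar values near
    x0 and equal to the trace at x0 ([casimir]).  The same operator shows that
    the algebra of equivariant maps is simple, because it sends a suitable
    nonzero element of an ideal to a nonzero central element of that ideal.

    Finally, the elements of Q have central denominators because a regular
    element s of k_n[X] divides a nonzero central element
    ([regular_central_multiple]): in the relation of Cayley and Hamilton, whose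
    coefficients are invariant functions, one may cancel s until the constant
    term is nonzero. *)

(** * The central polynomial of Formanek *)
Section Formanek.
Variables (k : fieldType) (n : nat).
Local Notation N := n.+1.

(** In the linear factors of [formanekPoly], the last variable takes the place
    of the variable 0 on the right; this is what forces a path with nonzero
    weight to be closed. *)
Definition closing (s : 'I_N) : 'I_N.+1 :=
  if s == 0 then ord_max else widen_ord (leqnSn N) s.

(** Evaluated along a path of indices of distinct scalars, this polynomial
    vanishes unless the first N indices are pairwise distinct and the last one
    equals the first one; its other values are all equal to [discr]. *)
Definition formanekPoly : {mpoly k[N.+1]} :=
  \prod_(st : 'I_N * 'I_N | st.1 != st.2)
    ('X_(widen_ord (leqnSn N) st.1) - 'X_(closing st.2)).

Section Operator.
Variable A : algType k.

(** A monomial of exponent m is read as the noncommutative word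
    u^m_0 y_0 u^m_1 y_1 ... y_n u^m_N, where y_p is a and the other letters y_s
    are v; the two factors below are the parts of the word around a. *)
Definition formanekL (m : 'X_{1..N.+1}) (p : 'I_N) (u v : A) : A :=
  (\prod_(0 <= s < p) (u ^+ m (inord s) * v)) * u ^+ m (inord p).

Definition formanekR (m : 'X_{1..N.+1}) (p : 'I_N) (u v : A) : A :=
  (\prod_(p.+1 <= s < N) (u ^+ m (inord s) * v)) * u ^+ m ord_max.

(** The sum over p of all the cyclic positions of the letter a is what makes the
    values central: for a diagonal u, one position gives a combination of diagonal
    matrix units, and the other positions complete each of them to the identity. *)
Definition formanek (u v a : A) : A :=
  \sum_(p < N) \sum_(m <- msupp formanekPoly)
    formanekPoly@_m *: (formanekL m p u v * a * formanekR m p u v).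

End Operator.

Section Morphism.
Variables (A B : algType k) (f : A -> B).
Hypotheses (fM : {morph f : x y / x * y}) (f1 : f 1 = 1).

Lemma morph_exp x e : f (x ^+ e) = f x ^+ e.
Proof. by elim: e => [|e IH]; rewrite ?expr0 ?f1 // [in LHS]exprSr fM IH exprSr. Qed.

Lemma formanekL_morph m p u v : f (formanekL m p u v) = formanekL m p (f u) (f v).
Proof.
rewrite fM morph_exp (big_morph f fM f1); congr (_ * _).
by apply: eq_bigr => s _; rewrite fM morph_exp.
Qed.

Lemma formanekR_morph m p u v : f (formanekR m p u v) = formanekR m p (f u) (f v).
Proof.
rewrite fM morph_exp (big_morph f fM f1); congr (_ * _).
by apply: eq_bigr => s _; rewrite fM morph_exp.
Qed.

Lemma formanek_morph :
    {morph f : x y / x + y} -> (forall c, {morph f : x / c *: x}) ->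
  forall u v a, f (formanek u v a) = formanek (f u) (f v) (f a).
Proof.
move=> fD fZ u v a; have f0 : f 0 = 0 by rewrite -(scale0r (0 : A)) fZ scale0r.
rewrite (big_morph f fD f0); apply: eq_bigr => p _.
rewrite (big_morph f fD f0); apply: eq_bigr => m _.
by rewrite fZ 2!fM formanekL_morph formanekR_morph.
Qed.

End Morphism.

Lemma formanek_word (A : algType k) (m : 'X_{1..N.+1}) (p : 'I_N) (u v a : A) :
  formanekL m p u v * a * formanekR m p u v =
  \prod_(s < N.+1) (u ^+ m s *
     (if s == N :> nat then 1 else if s == p :> nat then a else v)).
Proof.
pose E (s : nat) : A := u ^+ m (inord s) *
  (if s == N then 1 else if s == p then a else v).
transitivity (\prod_(s < N.+1) E s); last first.
  by apply: eq_bigr => s _; rewrite /E inord_val.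
rewrite -(big_mkord xpredT) big_nat_recr //= {2}/E eqxx mulr1.
rewrite (big_cat_nat (n := p)) ?(ltnW (ltn_ord p)) //= (big_ltn (ltn_ord p)).
rewrite {2}/E eqxx (ltn_eqF (ltn_ord p)) /formanekL /formanekR !mulrA.
have -> : inord N = ord_max :> 'I_N.+1 by apply/val_inj; rewrite /= inordK.
congr (_ * _ * _ * _ * _).
  apply: eq_big_nat => s /andP [_ sp]; rewrite /E (ltn_eqF sp).
  by rewrite (ltn_eqF (ltn_trans sp (ltn_ord p))).
apply: eq_big_nat => s /andP [ps sN]; rewrite /E (ltn_eqF sN).
by rewrite (gtn_eqF ps).
Qed.

Lemma delta_mul_delta (a b c d : 'I_N) (M : 'M[k]_N) :
  delta_mx a b * M * delta_mx c d = M b c *: delta_mx a d.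
Proof.
apply/matrixP => i j; rewrite !mxE (bigD1 c) //= big1 ?addr0 => [|l lc]; last first.
  by rewrite [X in _ * X]mxE (negPf lc) mulr0.
rewrite [X in _ * X]mxE eqxx /= !mxE (bigD1 b) //= big1 ?addr0 => [|l lb].
  by rewrite !mxE eqxx andbT mulrAC -natrM mulnb mulrC.
by rewrite !mxE (negPf lb) andbF mul0r.
Qed.

Lemma prod_delta_path (L : nat) (i : nat -> 'I_N) (Y : nat -> 'M[k]_N) :
  \prod_(s < L.+1) (delta_mx (i s) (i s) * Y s) =
  (\prod_(s < L) Y s (i s) (i s.+1)) *: (delta_mx (i 0%N) (i L) * Y L).
Proof.
elim: L => [|L IH]; first by rewrite big_ord_recl !big_ord0 mulr1 scale1r.
rewrite big_ord_recr IH /= big_ord_recr /= -scalerAl mulrA.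
by rewrite delta_mul_delta -scalerAl scalerA.
Qed.

Lemma diag_mx_exp (d : 'rV[k]_N) e :
  diag_mx d ^+ e = \sum_i d 0 i ^+ e *: delta_mx i i.
Proof.
have -> : diag_mx d ^+ e = diag_mx (\row_i d 0 i ^+ e).
  elim: e => [|e IH].
    by rewrite expr0; apply/matrixP => i j; rewrite !mxE expr0.
  rewrite exprSr IH; apply/matrixP => i j; rewrite !mxE (bigD1 j) //=.
  rewrite big1 ?addr0 => [|l lj]; last by rewrite !mxE (negPf lj) mulr0n mulr0.
  rewrite !mxE eqxx mulr1n.
  by case: eqP => [->|_]; rewrite ?mulr1n ?exprSr // !mulr0n mul0r.
apply/matrixP => i j; rewrite !mxE summxE (bigD1 i) //= big1 ?addr0 => [|l li].
  by rewrite !mxE eqxx /= [j == i]eq_sym; case: (i == j); rewrite ?mulr1 // mulr0.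
by rewrite !mxE [i == l]eq_sym (negPf li) mulr0.
Qed.

(** Writing the powers of a diagonal matrix as combinations of the diagonal
    matrix units turns a word into a sum over paths of indices, in which the
    polynomial gets evaluated. *)
Lemma formanek_paths (d : 'rV[k]_N) (Y : nat -> 'M[k]_N) : Y N = 1 ->
  \sum_(m <- msupp formanekPoly) formanekPoly@_m *:
     \prod_(s < N.+1) (diag_mx d ^+ m s * Y s) =
  \sum_(i : {ffun 'I_N.+1 -> 'I_N})
     (formanekPoly.@[fun s => d 0 (i s)]
        * \prod_(s < N) Y s (i (inord s)) (i (inord s.+1)))
      *: delta_mx (i ord0) (i ord_max).
Proof.
move=> YN; transitivity (\sum_(m <- msupp formanekPoly)
    \sum_(i : {ffun 'I_N.+1 -> 'I_N})
     (formanekPoly@_m * \prod_s d 0 (i s) ^+ m s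
        * \prod_(s < N) Y s (i (inord s)) (i (inord s.+1)))
      *: delta_mx (i ord0) (i ord_max)).
  apply: eq_bigr => m _.
  under eq_bigr => s _ do rewrite diag_mx_exp mulr_suml.
  rewrite bigA_distr_bigA scaler_sumr; apply: eq_bigr => i _ /=.
  under eq_bigr => s _ do rewrite -scalerAl.
  rewrite scaler_prod -!scalerA; congr (_ *: (_ *: _)).
  transitivity (\prod_(s < N.+1) (delta_mx (i (inord s)) (i (inord s)) * Y s)).
    by apply: eq_bigr => s _; rewrite inord_val.
  rewrite (@prod_delta_path N (fun s => i (inord s))) YN mulr1.
  by congr (_ *: delta_mx (i _) (i _)); apply/val_inj; rewrite /= inordK.
rewrite exchange_big; apply: eq_bigr => i _ /=.
by rewrite mevalE !mulr_suml scaler_suml.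
Qed.

Definition discr (d : 'rV[k]_N) : k :=
  \prod_(ab : 'I_N * 'I_N | ab.1 != ab.2) (d 0 ab.1 - d 0 ab.2).

Lemma discr_neq0 (d : 'rV[k]_N) : injective (d 0) -> discr d != 0.
Proof.
move=> dI; rewrite prodf_seq_neq0; apply/allP => -[a b] _ /=.
by apply/implyP => ab; rewrite subr_eq0 (inj_eq dI).
Qed.

Lemma formanekPolyE (v : 'I_N.+1 -> k) :
  formanekPoly.@[v] = \prod_(st : 'I_N * 'I_N | st.1 != st.2)
    (v (widen_ord (leqnSn N) st.1) - v (closing st.2)).
Proof.
rewrite /formanekPoly rmorph_prod; apply: eq_bigr => st _.
by rewrite raddfB /= !mevalXU.
Qed.

Definition close_path (t : {ffun 'I_N -> 'I_N}) : {ffun 'I_N.+1 -> 'I_N} :=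
  [ffun s : 'I_N.+1 => if s == ord_max then t ord0 else t (inord s)].

Definition open_path (i : {ffun 'I_N.+1 -> 'I_N}) : {ffun 'I_N -> 'I_N} :=
  [ffun s => i (widen_ord (leqnSn N) s)].

Lemma widen_neq_max (s : 'I_N) : (widen_ord (leqnSn N) s == ord_max) = false.
Proof. by apply/eqP => /(congr1 val) /= sN; have := ltn_ord s; rewrite sN ltnn. Qed.

Lemma close_pathK : cancel close_path open_path.
Proof.
move=> t; apply/ffunP => s; rewrite !ffunE widen_neq_max.
by congr (t _); apply/val_inj; rewrite /= inordK.
Qed.

Lemma open_pathK (i : {ffun 'I_N.+1 -> 'I_N}) :
  i ord_max = i ord0 -> close_path (open_path i) = i.
Proof.
move=> ie; apply/ffunP => s; rewrite !ffunE; case: eqP => [->|/eqP sN].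
  by rewrite ie; congr (i _); apply/val_inj.
congr (i _); apply/val_inj; rewrite /= inordK // ltn_neqAle -ltnS ltn_ord andbT.
exact: sN.
Qed.

(** The first N indices of the path are distinct, so they exhaust the indices,
    and the last index, which differs from all of them except the first one, must
    be the first one. *)
Lemma formanekPoly_path (d : 'rV[k]_N) (i : {ffun 'I_N.+1 -> 'I_N}) :
  formanekPoly.@[fun s => d 0 (i s)] != 0 ->
  injectiveb (open_path i) /\ i ord_max = i ord0.
Proof.
rewrite formanekPolyE prodf_seq_neq0 => /allP H.
have {}H s t : s != t -> i (widen_ord (leqnSn N) s) != i (closing t).
  move=> st; have /implyP /= := H (s, t) (mem_index_enum _).
  by move=> /(_ st); apply: contraNneq => ->; rewrite subrr.
have inj : injective (open_path i).
  move=> s t; rewrite !ffunE; apply: contra_eq => st.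
  have [t0|t0] := eqVneq t 0; last by have := H _ _ st; rewrite /closing (negPf t0).
  rewrite eq_sym; have := H t s; rewrite eq_sym st => /(_ isT).
  by rewrite /closing -[s == 0](inj_eq val_inj) /= -(inj_eq val_inj) /= t0 in st *;
     rewrite (negPf st).
split; first exact/injectiveP.
have /codomP [s] : i ord_max \in codom (open_path i).
  exact: inj_card_onto inj (leqnn _) _.
rewrite ffunE => is_; rewrite is_; have [->|s0] := eqVneq s 0.
  by congr (i _); apply/val_inj.
by have := H s 0 s0; rewrite /closing eqxx is_ eqxx.
Qed.

Lemma formanekPoly_close (d : 'rV[k]_N) (t : {ffun 'I_N -> 'I_N}) :
  injectiveb t -> formanekPoly.@[fun s => d 0 (close_path t s)] = discr d.
Proof.
move=> /injectiveP tI; rewrite formanekPolyE /discr.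
have tW s : close_path t (widen_ord (leqnSn N) s) = t s.
  by rewrite -[in RHS](close_pathK t) [RHS]ffunE.
have tC s : close_path t (closing s) = t s.
  rewrite /closing; case: eqP => [->|_]; last exact: tW.
  by rewrite ffunE eqxx; congr (t _); apply/val_inj.
rewrite [RHS](reindex (fun st => (t st.1, t st.2))) /=.
  by apply: eq_big => [[a b]|[a b] _] /=; rewrite ?(inj_eq tI) // tW tC.
apply: onW_bij; have [g tK gK] := injF_bij tI.
by exists (fun st => (g st.1, g st.2)) => -[a b] /=; rewrite ?tK ?gK.
Qed.

Lemma formanek_cycles (d : 'rV[k]_N) (Y : nat -> 'M[k]_N) : Y N = 1 ->
  \sum_(m <- msupp formanekPoly) formanekPoly@_m *:
     \prod_(s < N.+1) (diag_mx d ^+ m s * Y s) =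
  \sum_(t : {ffun 'I_N -> 'I_N} | injectiveb t)
     (discr d * \prod_(s < N) Y s (t s) (t (ordS s))) *: delta_mx (t 0) (t 0).
Proof.
move=> YN; rewrite formanek_paths //.
pose P (i : {ffun 'I_N.+1 -> 'I_N}) := injectiveb (open_path i) && (i ord_max == i ord0).
rewrite (bigID P) /= [X in _ + X]big1 ?addr0 => [|i]; last first.
  move=> nP; have [->|/formanekPoly_path [H1 H2]] :=
    eqVneq (formanekPoly.@[fun s => d 0 (i s)]) 0; first by rewrite mul0r scale0r.
  by rewrite /P H1 H2 eqxx in nP.
rewrite (reindex_onto close_path open_path) /=; last first.
  by move=> i /andP [_ /eqP /open_pathK].
have c0 t : close_path t ord0 = t 0.
  rewrite ffunE -(inj_eq val_inj) /=.
  by congr (t _); apply/val_inj; rewrite /= inordK.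
have cm t : close_path t ord_max = t 0 by rewrite ffunE eqxx; congr (t _); apply/val_inj.
apply: eq_big => [t|t]; rewrite /P close_pathK ?eqxx ?andbT ?c0 ?cm ?eqxx ?andbT //.
move=> tI; rewrite formanekPoly_close //; congr ((_ * _) *: _).
apply: eq_bigr => s _; congr (Y s _ _).
  rewrite ffunE -(inj_eq val_inj) /= inordK ?ltnS ?(ltnW (ltn_ord s)) //.
  by rewrite (ltn_eqF (ltn_ord s)) inord_val.
rewrite ffunE -(inj_eq val_inj) /= inordK; last by rewrite ltnS.
case: eqP => [sN|sN]; congr (t _); apply/val_inj => /=.
  by rewrite sN modnn.
have sN' : (s.+1 < N)%N by rewrite ltn_neqAle ltn_ord andbT; apply/eqP.
by rewrite inordK // modn_small.
Qed.

(** The sum over the Hamiltonian cycles t_0, t_1, ..., t_n of the products of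
    the corresponding entries of the matrices, a being used at the first step. *)
Definition cycle_sum (v a : 'M[k]_N) : k :=
  \sum_(t : {ffun 'I_N -> 'I_N} | injectiveb t)
    \prod_(s < N) (if s == 0 then a else v) (t s) (t (ordS s)).

Lemma ordSD (p t : 'I_N) : ordS (p + t) = p + ordS t.
Proof. by apply/val_inj; rewrite /= modnDmr addnS -[((p + t) %% N).+1]addn1 modnDml addn1. Qed.

Lemma formanek_diag (d : 'rV[k]_N) (v a : 'M[k]_N) :
  formanek (diag_mx d) v a = (discr d * cycle_sum v a)%:M.
Proof.
rewrite /formanek; transitivity (\sum_(p < N)
  \sum_(t : {ffun 'I_N -> 'I_N} | injectiveb t)
     (discr d * \prod_(s < N) (if s == 0 then a else v) (t s) (t (ordS s)))
     *: delta_mx (t (- p)) (t (- p))).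
  apply: eq_bigr => p _; under eq_bigr => m _ do rewrite formanek_word.
  rewrite (@formanek_cycles d (fun s => if s == N then 1 else if s == p then a else v))
    ?eqxx //.
  pose sh (t : {ffun 'I_N -> 'I_N}) := [ffun s => t (s - p)].
  have shI : injective sh.
    move=> t1 t2 /ffunP e; apply/ffunP => s; have := e (s + p).
    by rewrite !ffunE addrK.
  rewrite (reindex_inj shI); apply: eq_big => [t|t _].
    apply/injectiveP/injectiveP => tI a1 a2.
      by move=> e; apply: (addIr p); apply: tI; rewrite !ffunE !addrK.
    by rewrite !ffunE => /tI /addIr.
  rewrite !ffunE sub0r (reindex_inj (addrI p)) /=.
  congr ((_ * _) *: _); apply: eq_bigr => s _.
  have pK (x : 'I_N) : p + x - p = x by rewrite addrAC subrr add0r.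
  rewrite !ffunE ordSD !pK (ltn_eqF (ltn_pmod _ (ltn0Sn n))).
  have -> : (((p + s) %% N)%N == p) = (s == 0).
    by rewrite -[LHS]/(val (p + s) == val p) (inj_eq val_inj) -subr_eq0 pK.
  by [].
rewrite exchange_big /= /cycle_sum mulr_sumr rmorph_sum; apply: eq_bigr => t /injectiveP tI.
rewrite /= -scaler_sumr -[RHS]scalemx1; congr (_ *: _).
have tN : injective (fun p => t (- p)) by move=> a1 a2 /tI /oppr_inj.
rewrite -(reindex_inj tN (P := xpredT) (F := fun i => delta_mx i i)) /=.
apply/matrixP => i j; rewrite !mxE summxE (bigD1 i) //= big1 ?addr0 => [|l li].
  by rewrite !mxE eqxx [j == i]eq_sym.
by rewrite !mxE [i == l]eq_sym (negPf li).
Qed.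

End Formanek.

(** * Matrices with simple spectrum *)
Section SimpleSpectrum.
Variables (k : fieldType) (n : nat).
Local Notation N := n.+1.

Definition shift_mx : 'M[k]_N := \matrix_(i, j) (j == ordS i)%:R.

(** Only one cycle starts with the step from 0 to 1 and follows the shift.  With
    the shift in place of the matrix unit all the N rotations of this cycle would
    count, and their number N may vanish in k. *)
Lemma cycle_sum_shift : cycle_sum shift_mx (delta_mx 0 (ordS 0)) = 1.
Proof.
have E (t : {ffun 'I_N -> 'I_N}) s :
    (if s == 0 then delta_mx 0 (ordS 0) else shift_mx) (t s) (t (ordS s))
    = ((s == 0) ==> (t s == 0) && (t (ordS s) == ordS (t s)))%:R
      * ((s != 0) ==> (t (ordS s) == ordS (t s)))%:R :> k.
  case: eqP => [->|_] /=; rewrite mxE ?mulr1 ?mul1r //.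
  by case: eqP => //= ->.
pose id_path : {ffun 'I_N -> 'I_N} := [ffun s => s].
rewrite /cycle_sum (bigD1 id_path) /=; last first.
  by apply/injectiveP => s1 s2; rewrite !ffunE.
rewrite big1 => [|s _]; last first.
  by rewrite E !ffunE eqxx; case: (s == 0); rewrite mulr1.
rewrite big1 ?addr0 // => t /andP [_ tN]; apply/eqP; rewrite prodf_seq_eq0.
apply: contraNT tN => /hasPn H; apply/eqP/ffunP => s; rewrite ffunE.
have {}H r : ((r == 0) ==> (t r == 0)) && (t (ordS r) == ordS (t r)).
  have := H r (mem_index_enum _); rewrite /= E -natrM mulnb.
  have nb (b : bool) : (b%:R != 0 :> k) = b by case: b; rewrite ?oner_neq0 ?eqxx.
  by rewrite nb; case: (r == 0) => /=; rewrite ?andbT.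
have t0 : t 0 = 0 by have /andP [/eqP] := H 0.
have tS r : t (ordS r) = ordS (t r) by have /andP [_ /eqP] := H r.
case: s => s; elim: s => [|s IH] sN.
  by have -> : Ordinal sN = 0 by apply/val_inj.
have sN' : (s < N)%N by apply: ltn_trans sN.
have -> : Ordinal sN = ordS (Ordinal sN').
  by apply/val_inj; rewrite /= modn_small.
by rewrite tS IH.
Qed.

(** The determinant of chi'(u), where chi is the characteristic polynomial of u:
    up to sign the discriminant of chi.  In this form it is a polynomial in the
    entries of u, and it is compatible with evaluation even when the degree of
    chi' drops in positive characteristic. *)
Definition spectral_det (R : comNzRingType) (u : 'M[R]_N) : R :=
  \det (horner_mx u (char_poly u)^`()).

Lemma spectral_det_map (R S : comNzRingType) (f : {rmorphism R -> S}) (u : 'M[R]_N) :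
  spectral_det (map_mx f u) = f (spectral_det u).
Proof.
by rewrite /spectral_det -map_char_poly deriv_map -map_horner_mx det_map_mx.
Qed.

Lemma char_poly_diag (d : 'rV[k]_N) :
  char_poly (diag_mx d) = \prod_(a <- [seq d 0 i | i <- enum 'I_N]) ('X - a%:P).
Proof.
rewrite char_poly_trig ?diag_mx_is_trig // big_map big_enum /=.
by apply: eq_bigr => i _; rewrite mxE eqxx mulr1n.
Qed.

Lemma char_poly_conj (u D P : 'M[k]_N) :
  P \in unitmx -> u * P = P * D -> char_poly u = char_poly D.
Proof.
move=> PU uP; have P0 : \det (map_mx polyC P) != 0.
  by rewrite det_map_mx polyC_eq0 -unitfE -unitmxE.
apply: (mulIf P0); rewrite [RHS]mulrC -!det_mulmx; congr (\det _).
rewrite /char_poly_mx mulmxBl mulmxBr mul_scalar_mx mul_mx_scalar -!map_mxM.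
by rewrite -[u *m P]/(u * P) uP.
Qed.

Lemma spectral_det_diag (d : 'rV[k]_N) :
  injective (d 0) -> spectral_det (diag_mx d) != 0.
Proof.
move=> dI; rewrite /spectral_det horner_mx_diag det_diag prodf_seq_neq0.
apply/allP => i _; apply/implyP => _; rewrite mxE.
have : separable_poly (char_poly (diag_mx d)).
  by rewrite char_poly_diag separable_prod_XsubC map_inj_uniq // enum_uniq.
rewrite unlock => /coprimep_root; apply.
by rewrite char_poly_diag root_prod_XsubC map_f // mem_enum.
Qed.
End SimpleSpectrum.

Section ScalarValues.
Variables (k : closedFieldType) (n : nat).
Local Notation N := n.+1.

(** If chi had a double root, chi'(u) would kill the corresponding eigenvector;
    so chi has distinct roots and u is diagonalizable. *)
Lemma simple_spectrum_diag (u : 'M[k]_N) : spectral_det u != 0 ->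
  exists P (d : 'rV[k]_N), [/\ P \in unitmx, injective (d 0) & u * P = P * diag_mx d].
Proof.
move=> u0; pose chi := char_poly u.
have [rs chiE] := closed_field_poly_normal chi.
have chiM : chi \is monic := char_poly_monic u.
rewrite (monicP chiM) scale1r in chiE.
have sep : separable_poly chi.
  rewrite unlock coprimep_def; apply: contraNT u0 => /closed_rootP [a].
  rewrite root_gcd => /andP [ra /eqP ra'].
  have /eigenvalueP [v uv v0] : eigenvalue u a by rewrite eigenvalue_root_char.
  apply/det0P; exists v => //.
  have horner_eigen q : v *m horner_mx u q = q.[a] *: v.
    elim/poly_ind: q => [|q c IH]; first by rewrite rmorph0 horner0 scale0r mulmx0.
    rewrite rmorphD rmorphM /= horner_mx_X horner_mx_C mulmxDr mulmxA IH.
    by rewrite -scalemxAl uv scalerA mul_mx_scalar -scalerDl !hornerE.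
  by rewrite horner_eigen ra' scale0r.
have urs : uniq rs by rewrite -separable_prod_XsubC -chiE.
have [P PU /(similar_diagLR PU) [d uE]] : diagonalizable u.
  by apply/diagonalizableP; exists rs; rewrite // -chiE mxminpoly_dvd_char.
have uP : u * invmx P = invmx P * diag_mx d.
  by rewrite uE conjVmx // -mulmxA -[_ * _]/(_ *m _) -!mulmxA mulmxV // mulmx1.
exists (invmx P), d; split; [by rewrite unitmx_inv | | exact: uP].
move: sep; rewrite /chi (char_poly_conj _ uP) ?unitmx_inv // char_poly_diag.
by rewrite separable_prod_XsubC => ud; apply/injectiveP.
Qed.

Lemma formanek_scalar (u v a : 'M[k]_N) : spectral_det u != 0 ->
  is_scalar_mx (formanek n u v a).
Proof.
move=> /simple_spectrum_diag [P [d [PU dI uP]]].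
pose f (x : 'M[k]_N) := invmx P *m x *m P.
have fD : {morph f : x y / x + y} by move=> x y; rewrite /f mulmxDr mulmxDl.
have fZ c : {morph f : x / c *: x} by move=> x; rewrite /f -scalemxAr -scalemxAl.
have fM : {morph f : x y / x * y}.
  by move=> x y; rewrite /f -[RHS]/(_ *m _) !mulmxA mulmxK.
have f1 : f 1 = 1 by rewrite /f mulmx1 mulVmx.
have := formanek_morph n fM f1 fD fZ u v a.
have -> : f u = diag_mx d.
  by rewrite /f -mulmxA -[u *m P]/(u * P) uP mulmxA mulVmx // mul1mx.
rewrite formanek_diag => /(congr1 (fun x => P *m x *m invmx P)).
rewrite /f !mulmxA mulmxV // mul1mx mulmxK // => ->.
by rewrite mul_mx_scalar -scalemxAl mulmxV // scalemx1 scalar_mx_is_scalar.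
Qed.

End ScalarValues.

Section Distinct.
Lemma distinct_elements (k : closedFieldType) (r : nat) :
  exists d : 'rV[k]_r, injective (d 0).
Proof.
suff [s [us ss]] : exists s : seq k, uniq s /\ size s = r.
  exists (\row_i s`_i) => i j; rewrite !mxE => /eqP.
  by rewrite nth_uniq ?ss // => /eqP /val_inj.
elim: r => [|r [s [us ss]]]; first by exists [::].
have /closed_nonrootP [x] : \prod_(a <- s) ('X - a%:P) != 0 :> {poly k}.
  by rewrite monic_neq0 // monic_prod_XsubC.
rewrite root_prod_XsubC => xs; exists (x :: s); split=> /=; last by rewrite ss.
by rewrite xs.
Qed.
End Distinct.

(** * Neighborhoods in the variety and the generic matrix ring *)
Section Near.
Variables (k : closedFieldType) (m n : nat) (X : irrNVariety k m n).
Local Notation N := n.+1.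
Local Notation pt := (Defs.point k m n).
Local Notation G := (genericRing k m n).

(** A single polynomial witnesses that P holds near x0; products of witnesses
    serve for conjunctions. *)
Definition near (x0 : pt) (P : pt -> Prop) : Prop :=
  exists2 h : coordPoly k m n, peval x0 h != 0
    & forall x, nvar_set X x -> peval x h != 0 -> P x.

Lemma near_and x0 P Q : near x0 P -> near x0 Q -> near x0 (fun x => P x /\ Q x).
Proof.
move=> [g g0 gP] [h h0 hQ]; exists (g * h).
  by rewrite rmorphM mulf_neq0.
by move=> x Xx; rewrite rmorphM mulf_eq0 negb_or => /andP [/(gP x Xx) ? /(hQ x Xx)].
Qed.

Lemma near_mono x0 (P Q : pt -> Prop) :
  (forall x, nvar_set X x -> P x -> Q x) -> near x0 P -> near x0 Q.
Proof. by move=> PQ [h h0 hP]; exists h => // x Xx /(hP x Xx) /PQ; apply. Qed.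

Lemma near_true x0 (P : pt -> Prop) :
  (forall x, nvar_set X x -> P x) -> near x0 P.
Proof. by move=> HP; exists 1 => [|x Xx _]; rewrite ?rmorph1 ?oner_eq0 //; apply: HP. Qed.

Lemma near_all x0 (I : finType) (P : I -> pt -> Prop) :
  (forall i, near x0 (P i)) -> near x0 (fun x => forall i, P i x).
Proof.
move=> HP; have {}HP i : exists h : coordPoly k m n, peval x0 h != 0
    /\ forall x, nvar_set X x -> peval x h != 0 -> P i x.
  by have [h] := HP i; exists h.
have [h hP] := choice HP.
exists (\prod_i h i).
  by rewrite rmorph_prod prodf_seq_neq0; apply/allP => i _; have [] := hP i.
move=> x Xx; rewrite rmorph_prod prodf_seq_neq0 => /allP H i.
by have [_] := hP i; apply=> //; apply: H; rewrite mem_index_enum.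
Qed.

Lemma near_at x0 P : nvar_set X x0 -> near x0 P -> P x0.
Proof. by move=> Xx0 [h h0]; apply. Qed.

Lemma near_open x0 U : open_in X U -> U x0 -> near x0 U.
Proof.
move=> [Z [S ->] ->] [Xx0 /= /existsNP [h /not_implyP [Sh /eqP h0]]].
by exists h => // x Xx hx; split=> // H; rewrite H ?eqxx // in hx.
Qed.

(** This is where irreducibility is used: nonempty open subsets are dense. *)
Lemma near_dense x0 P : nvar_set X x0 -> near x0 P ->
  exists2 U, dense_open X U & forall x, U x -> nvar_set X x /\ P x.
Proof.
move=> Xx0 [h h0 hP]; pose Z := [set x : pt | forall q, [set h] q -> peval x q = 0].
have hZ x : Z x <-> peval x h = 0.
  by split=> [|hx q ->//]; apply.
have cZ : zclosed Z by exists [set h].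
exists (nvar_set X `\` Z); last first.
  by move=> x [Xx nZ]; split=> //; apply: hP => //; apply/eqP => /hZ.
split; first by exists Z.
move=> _ [Z2 cZ2 ->] [y [Xy Z2y]].
have [_ irr] := nvar_irreducible X.
apply: contrapT => nI; case: (irr Z Z2 cZ cZ2) => [x Xx|H|H].
- apply: contrapT => /not_orP [nZ nZ2]; apply: nI; exists x.
  by split; split.
- by have /hZ/eqP := H _ Xx0; rewrite (negPf h0).
- exact: Z2y (H _ Xy).
Qed.

Lemma near_det x0 d (M : 'M[coordPoly k m n]_d) :
  \det (map_mx (peval x0) M) != 0 ->
  near x0 (fun x => \det (map_mx (peval x) M) != 0).
Proof.
by rewrite det_map_mx => h0; exists (\det M) => // x _; rewrite det_map_mx.
Qed.

Lemma near_unit x0 (p : G) : gr_eval x0 p \in unitmx ->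
  near x0 (fun x => gr_eval x p \in unitmx).
Proof.
rewrite unitmxE unitfE => /near_det; apply: near_mono => x _.
by rewrite unitmxE unitfE.
Qed.

Lemma gr_evalZ x c (p : G) : gr_eval x (c *: p) = c *: gr_eval x p.
Proof.
have vZ : gr_val (c *: p) = polyMx_scale c (gr_val p) by [].
apply/matrixP => i j; rewrite /gr_eval vZ !mxE rmorphM /=.
by rewrite /peval /= mevalC.
Qed.

Definition generator (h : 'I_m) : G.
Proof.
exists (genericMx k n h); apply/asboolP => S _; exact.
Defined.

Lemma gr_eval_generator x h : gr_eval x (generator h) = x h.
Proof.
apply/matrixP => i j; rewrite /gr_eval /= !mxE /coordVar /peval /= mevalXU.
by rewrite /coords enum_rankK.
Qed.

(** The elements p with this property form a subalgebra that contains the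
    generic matrices. *)
Lemma gr_eval_conj g x (p : G) : g \in unitmx ->
  gr_eval (tconj g x) p = g * gr_eval x p * invmx g.
Proof.
case: p => q qG gU.
pose S : {pred polyMx k m n} := [pred q | `[< map_mx (peval (tconj g x)) q =
   g * map_mx (peval x) q * invmx g >]].
suff : q \in S by rewrite inE.
apply: (elimT (asboolP _) qG).
  split.
  - by apply/asboolP; rewrite !map_mx1 mulr1 -[RHS]/(g *m _) mulmxV.
  - move=> c p1 p2 H1 H2; apply/asboolP.
    rewrite !inE in H1 H2.
    have mZ y r : map_mx (peval y) (c *: r : polyMx k m n) = c *: map_mx (peval y) r.
      by apply/matrixP => i j; rewrite !mxE rmorphM /= /peval /= mevalC.
    by rewrite !map_mxD !mZ H1 H2 mulrDr mulrDl -scalerAr -scalerAl.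
  - move=> p1 p2 H1 H2; apply/asboolP.
    rewrite !inE in H1 H2.
    by rewrite !map_mxM H1 H2 !mulmxE Defs.conjmxM.
move=> h; apply/asboolP.
have := gr_eval_generator (tconj g x) h; rewrite {1}/gr_eval => /= ->.
by have := gr_eval_generator x h; rewrite {1}/gr_eval => /= ->.
Qed.

(** The values at x form a subalgebra that contains the generators of the matrix
    algebra.  To see it as a subspace in the sense of the vector space library,
    take finitely many values spanning a subspace of maximal dimension. *)
Lemma gr_eval_surj x (M : 'M[k]_N) : nvar_set X x -> exists p : G, gr_eval x p = M.
Proof.
move=> Xx; have [XG _ _] := nvar_n_variety X.
have gx : genTuples x by apply: XG.
pose img (v : 'M[k]_N) := exists p : G, gr_eval x p = v.
pose D d := `[< exists s : seq 'M[k]_N, (forall v, v \in s -> img v)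
   /\ \dim <<s>>%VS = d >].
have D0 : exists d, D d.
  by exists 0%N; apply/asboolP; exists [::]; split=> //; rewrite span_nil dimv0.
have Dmax d : D d -> (d <= \dim {: 'M[k]_N})%N.
  by move=> /asboolP [s [_ <-]]; rewrite dimvS // subvf.
case: (ex_maxnP D0 Dmax) => d /asboolP [s [sI sd]] dmax.
have imgW v : img v <-> v \in <<s>>%VS.
  split=> [vI|].
    have ss : (<<s>> <= <<v :: s>>)%VS by rewrite span_cons addvSr.
    have : (\dim <<v :: s>> <= \dim <<s>>)%N.
      rewrite sd; apply: dmax; apply/asboolP; exists (v :: s); split=> // w.
      by rewrite inE => /orP [/eqP ->|/sI].
    rewrite (geq_leqif (dimv_leqif_sup ss)) => /subvP; apply.
    by rewrite memv_span // mem_head.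
  move=> vs; have {}vs : v \in <<in_tuple s>>%VS by [].
  rewrite (coord_span vs).
  have : forall i : 'I_(size s), img (in_tuple s)`_i.
    by move=> i; apply: sI; rewrite mem_nth.
  move=> /choice [p pE]; exists (\sum_i coord (in_tuple s) i v *: p i).
  by rewrite raddf_sum /=; apply: eq_bigr => i _; rewrite gr_evalZ pE.
apply/imgW; suff : (fullv <= <<s>>)%VS by move=> /subvP; apply; rewrite memvf.
rewrite -gx; apply: agenv_sub_modl.
  by rewrite -memvE; apply/imgW; exists 1; rewrite rmorph1.
apply/prodvP => u v ux /imgW [q <-].
have /imgW [p <-] : u \in <<s>>%VS.
  apply: (subvP _ _ ux); apply/span_subvP => w /mapP [h _ ->]; apply/imgW.
  by exists (generator h); rewrite gr_eval_generator.
by apply/imgW; exists (p * q); rewrite rmorphM.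
Qed.

End Near.

(** * Central elements and expansions with central coefficients *)
Section Casimir.
Variables (k : closedFieldType) (m n : nat) (X : irrNVariety k m n).
Local Notation N := n.+1.
Local Notation pt := (Defs.point k m n).
Local Notation G := (genericRing k m n).
Local Notation near := (near X).

Definition sandwich (A : nzRingType) (s : seq (A * A)) (a : A) : A :=
  \sum_(ab <- s) ab.1 * a * ab.2.

Definition ev_pair (x : pt) (ab : G * G) : 'M[k]_N * 'M[k]_N :=
  (gr_eval x ab.1, gr_eval x ab.2).

Lemma gr_eval_sandwich x (s : seq (G * G)) a :
  gr_eval x (sandwich s a) = sandwich [seq ev_pair x ab | ab <- s] (gr_eval x a).
Proof.
rewrite /sandwich raddf_sum big_map; apply: eq_bigr => ab _.
by rewrite /= !rmorphM.
Qed.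

Lemma sandwichP (A : algType k) (s : seq (A * A)) c a b :
  sandwich s (c *: a + b) = c *: sandwich s a + sandwich s b.
Proof.
rewrite /sandwich scaler_sumr -big_split /=; apply: eq_bigr => ab _.
by rewrite mulrDr mulrDl -scalerAr -scalerAl.
Qed.

Lemma sandwich_sum (A : algType k) (s : seq (A * A)) (I : finType) (c : I -> k) a :
  sandwich s (\sum_i c i *: a i) = \sum_i c i *: sandwich s (a i).
Proof.
have s0 : sandwich s 0 = 0 by rewrite /sandwich big1 // => ab _; rewrite mulr0 mul0r.
rewrite (@big_morph _ _ (sandwich s) 0 +%R) //.
  by apply: eq_bigr => i _; rewrite -[_ *: a i]addr0 sandwichP s0 addr0.
by move=> a1 a2; rewrite -[a1]scale1r sandwichP !scale1r.
Qed.

Lemma formanek_sandwich (u v : G) : exists s : seq (G * G), forall x A,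
  sandwich [seq ev_pair x ab | ab <- s] A
    = formanek n (gr_eval x u) (gr_eval x v) A.
Proof.
pose g := formanekPoly k n.
exists [seq (g@_e *: formanekL e p u v, formanekR e p u v)
         | p <- index_enum 'I_N, e <- msupp g] => x A.
rewrite /sandwich big_map big_allpairs_dep; apply: eq_bigr => p _.
apply: eq_bigr => e _ /=; rewrite gr_evalZ -!scalerAl.
have [f1 fM] := gr_eval_monoid x.
by rewrite (formanekL_morph fM f1) (formanekR_morph fM f1).
Qed.

Lemma formanekZ (u v a : 'M[k]_N) c :
  formanek n u v (c *: a) = c *: formanek n u v a.
Proof.
rewrite scaler_sumr; apply: eq_bigr => p _; rewrite scaler_sumr.
by apply: eq_bigr => e _; rewrite -scalerAr -scalerAl !scalerA mulrC.
Qed.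

(** Take u diagonal with distinct eigenvalues and v the shift at x0, so that
    [formanek] u v has a nonzero value at a matrix unit E.  Summing its values at
    the elements z_i a z'_i, where z_i(x0) a z'_i(x0) is the product of the
    i-th diagonal entry of a and E, produces the trace. *)
Lemma casimir x0 : nvar_set X x0 -> exists s : seq (G * G),
  near x0 (fun x => forall A, is_scalar_mx (sandwich [seq ev_pair x ab | ab <- s] A))
  /\ forall A, sandwich [seq ev_pair x0 ab | ab <- s] A = (\tr A)%:M.
Proof.
move=> Xx0; have [d dI] := distinct_elements k N.
have [u u0] := gr_eval_surj (diag_mx d) Xx0.
have [v v0] := gr_eval_surj (shift_mx k n) Xx0.
have [z zE] := choice (fun i : 'I_N => gr_eval_surj (delta_mx 0 i : 'M[k]_N) Xx0).
have [z' z'E] := choice (fun i : 'I_N => gr_eval_surj (delta_mx i (ordS 0) : 'M[k]_N) Xx0).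
have [s sE] := formanek_sandwich u v.
pose c := (discr d)^-1.
exists [seq (c *: (ab.1 * z i), z' i * ab.2) | i <- index_enum 'I_N, ab <- s].
have E x A : sandwich [seq ev_pair x ab | ab <- [seq (c *: (ab.1 * z i), z' i * ab.2)
      | i <- index_enum 'I_N, ab <- s]] A =
    c *: \sum_i formanek n (gr_eval x u) (gr_eval x v)
           (gr_eval x (z i) * A * gr_eval x (z' i)).
  rewrite /sandwich big_map big_allpairs_dep scaler_sumr; apply: eq_bigr => i _.
  rewrite -sE /sandwich big_map scaler_sumr; apply: eq_bigr => ab _ /=.
  by rewrite gr_evalZ -!scalerAl !rmorphM !mulrA.
split; last first.
  move=> A; rewrite E u0 v0; under eq_bigr => i _ do
    rewrite zE z'E delta_mul_delta formanekZ formanek_diag cycle_sum_shift mulr1.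
  rewrite -scaler_suml scalerA scale_scalar_mx mulrAC -/(\tr A) mulVf ?mul1r //.
  exact: discr_neq0.
have : near x0 (fun x => spectral_det (gr_eval x u) != 0).
  exists (spectral_det (gr_val u)) => [|x _]; last by rewrite -spectral_det_map.
  by rewrite -spectral_det_map -/(gr_eval x0 u) u0 spectral_det_diag.
apply: near_mono => x _ ux A; rewrite E.
rewrite (eq_bigr (fun i => (formanek n (gr_eval x u) (gr_eval x v)
   (gr_eval x (z i) * A * gr_eval x (z' i)) 0 0)%:M)) => [|i _].
  by rewrite -raddf_sum scale_scalar_mx scalar_mx_is_scalar.
have /is_scalar_mxP [b ->] := formanek_scalar (gr_eval x v)
  (gr_eval x (z i) * A * gr_eval x (z' i)) ux.
by rewrite mxE eqxx mulr1n.
Qed.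

(** The values, near x0, of an element of the generic matrix ring that takes
    scalar values near x0. *)
Definition central_fun x0 (phi : pt -> k) : Prop :=
  exists p : G, near x0 (fun x => gr_eval x p = (phi x)%:M).

Section Closure.
Variable x0 : pt.

Lemma central_cst c : central_fun x0 (fun=> c).
Proof.
by exists c%:A; apply: near_true => x _; rewrite gr_evalZ rmorph1 -scalemx1.
Qed.

Lemma central_add f g : central_fun x0 f -> central_fun x0 g ->
  central_fun x0 (fun x => f x + g x).
Proof.
move=> [p pP] [q qP]; exists (p + q); apply: near_mono (near_and pP qP).
by move=> x _ [e1 e2]; rewrite rmorphD /= e1 e2 -raddfD.
Qed.

Lemma central_mul f g : central_fun x0 f -> central_fun x0 g ->
  central_fun x0 (fun x => f x * g x).
Proof.
move=> [p pP] [q qP]; exists (p * q); apply: near_mono (near_and pP qP).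
by move=> x _ [e1 e2]; rewrite rmorphM /= e1 e2 -mulmxE -scalar_mxM.
Qed.

Lemma central_sum (I : Type) (r : seq I) (P : pred I) (f : I -> pt -> k) :
  (forall i, central_fun x0 (f i)) -> central_fun x0 (fun x => \sum_(i <- r | P i) f i x).
Proof.
move=> cf; elim: r => [|i r IH].
  by under eq_fun do rewrite big_nil; apply: central_cst.
by under eq_fun do rewrite big_cons; case: (P i) => //; apply: central_add.
Qed.

Lemma central_prod (I : Type) (r : seq I) (P : pred I) (f : I -> pt -> k) :
  (forall i, central_fun x0 (f i)) -> central_fun x0 (fun x => \prod_(i <- r | P i) f i x).
Proof.
move=> cf; elim: r => [|i r IH].
  by under eq_fun do rewrite big_nil; apply: central_cst.
by under eq_fun do rewrite big_cons; case: (P i) => //; apply: central_mul.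
Qed.

Lemma central_det d (M : pt -> 'M[k]_d) :
  (forall i j, central_fun x0 (fun x => M x i j)) -> central_fun x0 (fun x => \det (M x)).
Proof.
move=> cM; rewrite /determinant; apply: central_sum => s.
by apply: central_mul; [apply: central_cst | apply: central_prod].
Qed.

Lemma central_adj d (M : pt -> 'M[k]_d) i j :
  (forall i j, central_fun x0 (fun x => M x i j)) ->
  central_fun x0 (fun x => (\adj (M x)) i j).
Proof.
move=> cM; under eq_fun do rewrite mxE /cofactor.
apply: central_mul; first exact: central_cst.
by apply: central_det => a b; under eq_fun do rewrite !mxE.
Qed.

End Closure.

Definition coord_mx (w : 'I_(N * N) -> G) (x : pt) : 'M[k]_(N * N) :=
  \matrix_i mxvec (gr_eval x (w i)).

Lemma near_coord_mx x0 w : coord_mx w x0 \in unitmx ->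
  near x0 (fun x => coord_mx w x \in unitmx).
Proof.
pose M : 'M[coordPoly k m n]_(N * N) := \matrix_i mxvec (gr_val (w i)).
have E x : coord_mx w x = map_mx (peval x) M.
  apply/matrixP => i j; rewrite !mxE; case/mxvec_indexP: j => a b.
  by rewrite !mxvecE mxE.
rewrite unitmxE unitfE E => /(near_det X); apply: near_mono => x _.
by rewrite unitmxE unitfE E.
Qed.

Lemma coord_mx_expand w x (A : 'M[k]_N) : coord_mx w x \in unitmx ->
  A = \sum_i (mxvec A *m invmx (coord_mx w x)) 0 i *: gr_eval x (w i).
Proof.
move=> wU; apply: (can_inj mxvecK); rewrite linear_sum /=.
rewrite -[LHS](mulmxKV wU) [LHS]mulmx_sum_row; apply: eq_bigr => i _.
by rewrite linearZ rowK.
Qed.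

(** Let lam be the scalar value of the Casimir operator.  The coefficients of r
    in the basis w solve the linear system with matrix lam (w_i z_j) and right
    hand side lam (r z_j), all of whose entries are central functions.  The z_j
    are dual to the entries at x0, so that there the matrix of the system is
    [coord_mx w]; Cramer's rule gives delta as its determinant. *)
Lemma central_expansion x0 (w : 'I_(N * N) -> G) : nvar_set X x0 ->
  coord_mx w x0 \in unitmx ->
  exists delta, [/\ central_fun x0 delta, delta x0 != 0 & forall r : G,
    exists2 phi, forall i, central_fun x0 (phi i)
      & near x0 (fun x => delta x *: gr_eval x r = \sum_i phi i x *: gr_eval x (w i))].
Proof.
move=> Xx0 wU; have [s [sN s0]] := casimir Xx0.
pose T x := sandwich [seq ev_pair x ab | ab <- s].
have [z zE] := choice (fun j : 'I_(N * N) =>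
  gr_eval_surj (vec_mx (delta_mx 0 j))^T Xx0).
pose lam (a : G) x := (T x (gr_eval x a)) 0 0.
have lamC a : central_fun x0 (lam a).
  exists (sandwich s a); apply: near_mono sN => x _ Hx.
  rewrite gr_eval_sandwich /lam; have /is_scalar_mxP [c e] := Hx (gr_eval x a).
  by rewrite /T e mxE eqxx mulr1n.
pose Gam x := \matrix_(i, j) lam (w i * z j) x.
have GamC i j : central_fun x0 (fun x => Gam x i j).
  by under eq_fun do rewrite mxE; apply: lamC.
exists (fun x => \det (Gam x)); split.
- exact: central_det.
- suff -> : Gam x0 = coord_mx w x0 by rewrite -unitfE -unitmxE.
  apply/matrixP => i j; rewrite !mxE /lam /T s0 mxE eqxx mulr1n rmorphM /= zE.
  case/mxvec_indexP: j => a b; rewrite mxvecE vec_mx_delta trmx_delta.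
  rewrite /mxtrace (bigD1 a) //= big1 ?addr0 => [|c ca].
    rewrite mxE (bigD1 b) //= big1 ?addr0 => [|c cb].
      by rewrite [X in _ * X]mxE !eqxx mulr1.
    by rewrite [X in _ * X]mxE (negPf cb) mulr0.
  by rewrite mxE big1 // => l _; rewrite [X in _ * X]mxE (negPf ca) andbF mulr0.
move=> r; pose rho x := \row_j lam (r * z j) x.
exists (fun i x => (rho x *m \adj (Gam x)) 0 i).
  move=> i; under eq_fun do rewrite mxE; apply: central_sum => j.
  by apply: central_mul; [under eq_fun do rewrite mxE; apply: lamC | apply: central_adj].
apply: near_mono (near_coord_mx wU) => x Xx wx.
pose c := mxvec (gr_eval x r) *m invmx (coord_mx w x).
have -> : rho x = c *m Gam x.
  apply/rowP => j; rewrite !mxE /lam rmorphM /=.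
  rewrite {1}(coord_mx_expand (gr_eval x r) wx) mulr_suml.
  rewrite (eq_bigr (fun i => c 0 i *: gr_eval x (w i * z j))) => [|i _]; last first.
    by rewrite rmorphM scalerAl.
  rewrite /T sandwich_sum summxE; apply: eq_bigr => i _.
  by rewrite mxE [Gam x i j]mxE.
rewrite -mulmxA mul_mx_adj mul_mx_scalar.
rewrite {1}(coord_mx_expand (gr_eval x r) wx) scaler_sumr; apply: eq_bigr => i _.
by rewrite scalerA; congr (_ *: _); rewrite [RHS]mxE.
Qed.

End Casimir.

(** * Functions of the eigenvalues and eigenvectors of u *)
Section EigenvectorLemmas.
Variables (k : closedFieldType) (n : nat).
Local Notation N := n.+1.

Definition flatten_mx (T : Type) (f : 'I_N -> 'I_N -> T) (j : 'I_(N * N)) : T :=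
  let il := enum_val (cast_ord (esym (mxvec_cast N N)) j) in f il.1 il.2.

Lemma flatten_mxE T (f : 'I_N -> 'I_N -> T) i l :
  flatten_mx f (mxvec_index i l) = f i l.
Proof. by rewrite /flatten_mx cast_ordK enum_rankK. Qed.

Lemma sum_mxvec_index (V : nmodType) (f : 'I_(N * N) -> V) :
  \sum_j f j = \sum_i \sum_l f (mxvec_index i l).
Proof.
rewrite pair_bigA /= (reindex _ (curry_mxvec_bij N N)) /=.
by apply: eq_bigr => -[i l].
Qed.

Lemma eq_on_eigenvectors (u A B : 'M[k]_N) : spectral_det u != 0 ->
  (forall lambda (b : 'cV[k]_N), u *m b = lambda *: b -> b != 0 -> A *m b = B *m b) ->
  A = B.
Proof.
move=> /simple_spectrum_diag [P [d [PU _ uP]]] H.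
suff : A *m P = B *m P by move/(can_inj (mulmxK PU)).
suff E s : A *m col s P = B *m col s P.
  by apply/matrixP => a s; have /colP /(_ a) := E s; rewrite !colE !mulmxA -!colE !mxE.
apply: (H (d 0 s)).
  suff <- : col s (u *m P) = d 0 s *: col s P by rewrite !colE mulmxA.
  rewrite -[u *m P]/(u * P) uP; apply/colP => a.
  rewrite !mxE (bigD1 s) //= big1 ?addr0 => [|t ts].
    by rewrite !mxE eqxx mulr1n mulrC.
  by rewrite !mxE (negPf ts) mulr0n mulr0.
apply: contraTneq PU => cs; rewrite unitmxE unitfE negbK.
rewrite -det_tr; apply/det0P; exists (delta_mx 0 s).
  by apply/eqP => /matrixP /(_ 0 s) /eqP; rewrite !mxE !eqxx oner_eq0.
by rewrite -rowE -tr_col cs trmx0.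
Qed.

End EigenvectorLemmas.

Section EigenRepr.
Variables (k : closedFieldType) (m n : nat) (X : irrNVariety k m n).
Local Notation N := n.+1.
Local Notation pt := (Defs.point k m n).
Local Notation G := (genericRing k m n).
Local Notation near := (near X).
Local Notation central_fun := (central_fun X).
Variables (x0 : pt) (u : G).
Hypothesis Xx0 : nvar_set X x0.

Lemma central_near_neq0 phi : central_fun x0 phi -> phi x0 != 0 ->
  near x0 (fun x => phi x != 0).
Proof.
move=> [p pP] p0; have e0 := near_at Xx0 pP.
have : near x0 (fun x => gr_eval x p \in unitmx).
  by apply: near_unit; rewrite e0 unitmxE det_scalar unitrX // unitfE.
move/(near_and pP); apply: near_mono => x _ [->].
by rewrite unitmxE det_scalar unitfE; apply: contraNneq => ->; rewrite expr0n.
Qed.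

(** nu assigns a vector to a point x, an eigenvalue lambda and an eigenvector b
    of u(x).  It is representable if, up to a central factor, nu x lambda b is
    A(x) b for an A in the ring that does not depend on the eigenvector. *)
Definition eigen_repr (nu : pt -> k -> 'cV[k]_N -> 'cV[k]_N) : Prop :=
  exists A phi, [/\ central_fun x0 phi, phi x0 != 0
    & near x0 (fun x => forall lambda b, gr_eval x u *m b = lambda *: b ->
        gr_eval x A *m b = phi x *: nu x lambda b)].

Definition eigen_scalar (theta : pt -> k -> k) : Prop :=
  eigen_repr (fun x lambda b => theta x lambda *: b).

Lemma eigen_repr_ext nu nu' : (forall x lambda b, nu x lambda b = nu' x lambda b) ->
  eigen_repr nu -> eigen_repr nu'.
Proof.
move=> e [A [phi [c n0 H]]]; exists A, phi; split=> //.
by apply: near_mono H => x _ H lambda b /H ->; rewrite e.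
Qed.

Lemma eigen_repr_mull (p : G) nu : eigen_repr nu ->
  eigen_repr (fun x lambda b => gr_eval x p *m nu x lambda b).
Proof.
move=> [A [phi [c n0 H]]]; exists (p * A), phi; split=> //.
apply: near_mono H => x _ H lambda b /H e.
by rewrite rmorphM /= -mulmxE -mulmxA e scalemxAr.
Qed.

Lemma eigen_repr_add nu1 nu2 : eigen_repr nu1 -> eigen_repr nu2 ->
  eigen_repr (fun x lambda b => nu1 x lambda b + nu2 x lambda b).
Proof.
move=> [A1 [phi1 [c1 n1 H1]]] [A2 [phi2 [c2 n2 H2]]].
have [p1 P1] := c1; have [p2 P2] := c2.
exists (p2 * A1 + p1 * A2), (fun x => phi1 x * phi2 x); split.
- exact: central_mul.
- by rewrite mulf_neq0.
apply: near_mono (near_and (near_and H1 H2) (near_and P1 P2)).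
move=> x _ [[{}H1 {}H2] [{}P1 {}P2]] lambda b eb.
rewrite rmorphD !rmorphM /= -!mulmxE mulmxDl -!mulmxA (H1 _ _ eb) (H2 _ _ eb).
by rewrite P1 P2 !mul_scalar_mx !scalerA scalerDr mulrC.
Qed.

Lemma eigen_repr_scale theta nu : eigen_scalar theta -> eigen_repr nu ->
  eigen_repr (fun x lambda b => theta x lambda *: nu x lambda b).
Proof.
move=> [A1 [phi1 [c1 n1 H1]]] [A2 [phi2 [c2 n2 H2]]].
exists (A2 * A1), (fun x => phi1 x * phi2 x); split.
- exact: central_mul.
- by rewrite mulf_neq0.
apply: near_mono (near_and H1 H2) => x _ [{}H1 {}H2] lambda b eb.
rewrite rmorphM /= -mulmxE -mulmxA (H1 _ _ eb) -!scalemxAr (H2 _ _ eb).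
by rewrite !scalerA -mulrA -mulrA [theta _ _ * _]mulrC.
Qed.

Lemma eigen_repr_id : eigen_repr (fun _ _ b => b).
Proof.
exists 1, (fun=> 1); split; [exact: central_cst | exact: oner_neq0 |].
by apply: near_true => x _ lambda b _; rewrite rmorph1 mul1mx scale1r.
Qed.

Lemma eigen_repr_elt (p : G) : eigen_repr (fun x _ b => gr_eval x p *m b).
Proof. exact: eigen_repr_mull eigen_repr_id. Qed.

Lemma eigen_repr_sum (I : Type) (r : seq I) (nu : I -> pt -> k -> 'cV[k]_N -> 'cV[k]_N) :
  (forall i, eigen_repr (nu i)) ->
  eigen_repr (fun x lambda b => \sum_(i <- r) nu i x lambda b).
Proof.
move=> H; elim: r => [|i r IH].
  have := eigen_repr_elt 0; apply: eigen_repr_ext => x l b.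
  by rewrite rmorph0 mul0mx big_nil.
have := eigen_repr_add (H i) IH; apply: eigen_repr_ext => x l b.
by rewrite big_cons.
Qed.

Lemma eigen_scalar_central phi : central_fun x0 phi -> eigen_scalar (fun x _ => phi x).
Proof.
move=> [p pP]; exists p, (fun=> 1); split; [exact: central_cst | exact: oner_neq0 |].
by apply: near_mono pP => x _ -> l b _; rewrite mul_scalar_mx scale1r.
Qed.

Lemma eigen_scalar_cst c : eigen_scalar (fun _ _ => c).
Proof. by apply: eigen_scalar_central; apply: central_cst. Qed.

Lemma eigen_scalar_inv phi : central_fun x0 phi -> phi x0 != 0 ->
  eigen_scalar (fun x _ => (phi x)^-1).
Proof.
move=> c n0; exists 1, phi; split=> //.
apply: near_mono (central_near_neq0 c n0) => x _ nx l b _.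
by rewrite rmorph1 mul1mx scalerA mulfV ?scale1r.
Qed.

Lemma eigen_scalar_var : eigen_scalar (fun _ lambda => lambda).
Proof.
exists u, (fun=> 1); split; [exact: central_cst | exact: oner_neq0 |].
by apply: near_true => x _ l b; rewrite scale1r.
Qed.

Lemma eigen_scalar_mul t1 t2 : eigen_scalar t1 -> eigen_scalar t2 ->
  eigen_scalar (fun x lambda => t1 x lambda * t2 x lambda).
Proof.
move=> H1 H2; have := eigen_repr_scale H1 H2.
by apply: eigen_repr_ext => x l b; rewrite scalerA.
Qed.

Lemma eigen_scalar_exp t e : eigen_scalar t ->
  eigen_scalar (fun x lambda => t x lambda ^+ e).
Proof.
move=> H; elim: e => [|e IH]; first exact: eigen_scalar_cst.
have := eigen_scalar_mul H IH.
by apply: eigen_repr_ext => x l b; rewrite exprS.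
Qed.

Lemma eigen_scalar_prod (I : Type) (r : seq I) t :
  (forall i : I, eigen_scalar (t i)) ->
  eigen_scalar (fun x lambda => \prod_(i <- r) t i x lambda).
Proof.
move=> H; elim: r => [|i r IH].
  by apply: eigen_repr_ext (eigen_scalar_cst 1) => x l b; rewrite big_nil.
apply: eigen_repr_ext (eigen_scalar_mul (H i) IH) => x l b.
by rewrite big_cons.
Qed.

Lemma eigen_scalar_sum (I : Type) (r : seq I) t :
  (forall i : I, eigen_scalar (t i)) ->
  eigen_scalar (fun x lambda => \sum_(i <- r) t i x lambda).
Proof.
move=> H; apply: eigen_repr_ext (eigen_repr_sum r H) => x l b.
by rewrite scaler_suml.
Qed.

Lemma eigen_scalar_poly (y : pt -> k -> pt) (P : coordPoly k m n) :
  (forall h i j, eigen_scalar (fun x lambda => y x lambda h i j)) ->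
  eigen_scalar (fun x lambda => peval (y x lambda) P).
Proof.
move=> H; have {}H v : eigen_scalar (fun x lambda => coords (y x lambda) v).
  by rewrite /coords; case: (enum_val v) => -[h i] j; apply: H.
have E x lambda : peval (y x lambda) P = \sum_(e <- msupp P)
    P@_e * \prod_v coords (y x lambda) v ^+ e v by rewrite /peval mevalE.
have : eigen_scalar (fun x lambda => \sum_(e <- msupp P)
    P@_e * \prod_v coords (y x lambda) v ^+ e v).
  apply: eigen_scalar_sum => e; apply: eigen_scalar_mul; first exact: eigen_scalar_cst.
  by apply: eigen_scalar_prod => v; apply: eigen_scalar_exp.
by apply: eigen_repr_ext => x l b; rewrite E.
Qed.

End EigenRepr.

(** * Conjugating a point by a frame of eigenvectors *)
Section Splitting.
Variables (k : closedFieldType) (m n : nat) (X : irrNVariety k m n).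
Local Notation N := n.+1.
Local Notation pt := (Defs.point k m n).
Local Notation G := (genericRing k m n).
Local Notation near := (near X).
Local Notation central_fun := (central_fun X).

Variables (u : G) (v : 'I_N -> G).

Definition split_basis : 'I_(N * N) -> G := flatten_mx (fun i l => v i * u ^+ l).

Definition frame (x : pt) (b : 'cV[k]_N) : 'M[k]_N :=
  \matrix_(a, i) (gr_eval x (v i) *m b) a 0.

Lemma frame_mul x b (c : 'cV[k]_N) :
  frame x b *m c = \sum_i c i 0 *: (gr_eval x (v i) *m b).
Proof.
apply/colP => a; rewrite !mxE summxE; apply: eq_bigr => i _.
by rewrite [X in X * _]mxE [RHS]mxE mulrC.
Qed.

Lemma split_basis_eigen x (c : 'I_(N * N) -> k) lambda b :
  gr_eval x u *m b = lambda *: b ->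
  (\sum_j c j *: gr_eval x (split_basis j)) *m b =
  frame x b *m \col_i \sum_l c (mxvec_index i l) * lambda ^+ l.
Proof.
move=> ub; have uX e : gr_eval x u ^+ e *m b = lambda ^+ e *: b.
  elim: e => [|e IH]; first by rewrite !expr0 mul1mx scale1r.
  by rewrite exprSr -mulmxE -mulmxA ub -scalemxAr IH scalerA exprS mulrC.
rewrite frame_mul sum_mxvec_index mulmx_suml; apply: eq_bigr => i _.
rewrite mxE scaler_suml mulmx_suml; apply: eq_bigr => l _.
rewrite /split_basis flatten_mxE rmorphM rmorphXn /= -scalemxAl -mulmxE -mulmxA uX.
by rewrite -scalemxAr scalerA.
Qed.

(** Every vector is A b for some matrix A, and A is a combination of the
    v_i u^l, so the columns v_i b span. *)
Lemma frame_unit x lambda b : coord_mx split_basis x \in unitmx ->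
  gr_eval x u *m b = lambda *: b -> b != 0 -> frame x b \in unitmx.
Proof.
move=> wU ub b0; have [a ba] : exists a, b a 0 != 0.
  apply/existsP; apply: contraNT b0; rewrite negb_exists => /forallP H.
  by apply/eqP/colP => a; rewrite mxE; apply/eqP; have := H a; rewrite negbK.
have col_in t : exists c : 'cV_N, frame x b *m c = delta_mx t 0.
  pose A : 'M[k]_N := (b a 0)^-1 *: delta_mx t a.
  have bE : A *m b = delta_mx t 0.
    apply/colP => s; rewrite mxE (bigD1 a) //= big1 ?addr0 => [|r ra].
      by rewrite !mxE !eqxx andbT mulrAC mulVf // mul1r.
    by rewrite !mxE (negPf ra) andbF mulr0 mul0r.
  have := split_basis_eigen (fun j => (mxvec A *m invmx (coord_mx split_basis x)) 0 j) ub.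
  rewrite -(coord_mx_expand A wU) bE => e; exact: (ex_intro _ _ (esym e)).
have [c cE] := choice col_in.
pose C := \matrix_(i, t) c t i 0.
suff : frame x b *m C = 1%:M by case/mulmx1_unit.
apply/matrixP => s t; have /colP /(_ s) := cE t; rewrite !mxE eqxx andbT => <-.
by apply: eq_bigr => i _; rewrite [C i t]mxE.
Qed.

Variables (delta : pt -> k) (phi : 'I_m -> 'I_N -> 'I_(N * N) -> pt -> k).

(** The matrices of the X_h, acting from the left on the v_j, with coefficients
    in the polynomials in u; phi h j are delta times the coordinates of X_h v_j
    in the basis, and u is specialized to an eigenvalue. *)
Definition split_point (x : pt) (lambda : k) : pt := fun h => \matrix_(i, j)
  (\sum_(l < N) phi h j (mxvec_index i l) x * (delta x)^-1 * lambda ^+ l).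

Lemma frame_split_point x lambda b h : delta x != 0 ->
  (forall j, delta x *: gr_eval x (generator k n h * v j) =
     \sum_i phi h j i x *: gr_eval x (split_basis i)) ->
  gr_eval x u *m b = lambda *: b ->
  x h *m frame x b = frame x b *m split_point x lambda h.
Proof.
move=> d0 H ub; apply/matrixP => a j.
transitivity ((x h *m gr_eval x (v j) *m b) a 0).
  by rewrite -mulmxA !mxE; apply: eq_bigr => i _; rewrite [frame _ _ _ _]mxE.
have -> : x h *m gr_eval x (v j) =
    \sum_i (phi h j i x * (delta x)^-1) *: gr_eval x (split_basis i).
  under eq_bigr => i _ do rewrite mulrC -scalerA.
  rewrite -scaler_sumr -H scalerA mulVf // scale1r rmorphM /=.
  by rewrite gr_eval_generator mulmxE.
rewrite (split_basis_eigen (fun i => phi h j i x * (delta x)^-1) ub) !mxE.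
by apply: eq_bigr => i _; rewrite !mxE.
Qed.

End Splitting.

(** * Descent of equivariant rational maps *)
Section Descent.
Variables (k : closedFieldType) (m n : nat) (X : irrNVariety k m n).
Local Notation N := n.+1.
Local Notation pt := (Defs.point k m n).
Local Notation G := (genericRing k m n).
Local Notation near := (near X).
Local Notation central_fun := (central_fun X).
Variable x0 : pt.
Hypothesis Xx0 : nvar_set X x0.

(** The product of all the denominators serves for every index. *)
Lemma common_denominator (I : finType) (F : I -> pt -> k) :
  (forall i, exists P Q : coordPoly k m n,
     near x0 (fun x => peval x Q != 0 /\ F i x = peval x P / peval x Q)) ->
  exists (P : I -> coordPoly k m n) (Q : coordPoly k m n),
     near x0 (fun x => peval x Q != 0 /\ forall i, peval x Q * F i x = peval x (P i)).
Proof.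
move=> H; have [P {}H] := choice H; have [Q {}H] := choice H.
exists (fun i => P i * \prod_(j | j != i) Q j), (\prod_j Q j).
apply: near_mono (near_all H) => x _ {}H; split.
  by rewrite rmorph_prod prodf_seq_neq0; apply/allP => j _; have [] := H j.
move=> i; have [Qi ->] := H i; rewrite (bigD1 i) //= !rmorphM /=.
by rewrite [LHS]mulrC mulrA mulfVK.
Qed.

(** If w is a basis at x0, so is a w, and the expansion of 1 in the basis a w
    reads delta = a (sum_i phi_i w_i). *)
Lemma central_multiple (a : G) (kappa : k) : gr_eval x0 a = kappa%:M -> kappa != 0 ->
  exists (b c : G) , near x0 (fun x => exists2 z : k, z != 0 &
    gr_eval x c = z%:M /\ gr_eval x a * gr_eval x b = z%:M).
Proof.
move=> a0 k0.
have [w wE] := choice (fun j : 'I_(N * N) => gr_eval_surj (vec_mx (delta_mx 0 j)) Xx0).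
have w'U : coord_mx (fun j => a * w j) x0 \in unitmx.
  have -> : coord_mx (fun j => a * w j) x0 = kappa%:M.
    apply/row_matrixP => i; rewrite rowK rmorphM /= a0 wE -mulmxE mul_scalar_mx.
    by rewrite linearZ /= vec_mxK -scalemx1 linearZ /= row1.
  by rewrite unitmxE det_scalar unitrX // unitfE.
have [delta [dC d0 /(_ 1) [phi phiC H]]] := central_expansion Xx0 w'U.
have [p pP] := choice phiC; have [c cP] := dC.
exists (\sum_i p i * w i), c.
apply: near_mono (near_and (near_and (central_near_neq0 Xx0 dC d0) cP)
                           (near_and H (near_all pP))).
move=> x _ [[dx cx] [Hx px]]; exists (delta x) => //; split=> //.
have -> : (delta x)%:M = delta x *: gr_eval x 1 by rewrite rmorph1 scalemx1.
rewrite Hx raddf_sum /= mulr_sumr.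
by apply: eq_bigr => i _; rewrite !rmorphM /= px -mulmxE mul_scalar_mx -scalemxAr.
Qed.

(** The point x0 and the choices of the proof are such that at x0 every frame of
    eigenvectors b = e_s is the identity, hence y(x0, d_s) = x0.  This keeps all
    the points y(x, lambda), for x near x0, in the domain of F, although that
    domain need not be stable under conjugation. *)
Lemma descent (F : pt -> 'M[k]_N) (U : pt -> Prop) :
    (forall i j, exists P Q : coordPoly k m n,
      near x0 (fun x => peval x Q != 0 /\ F x i j = peval x P / peval x Q)) ->
    near x0 U ->
    (forall g x, g \in unitmx -> U x -> U (tconj g x) ->
      F (tconj g x) = g * F x * invmx g) ->
  exists p c : G, near x0 (fun x => exists2 z : k, z != 0 &
    gr_eval x c = z%:M /\ F x * gr_eval x c = gr_eval x p).
Proof.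
move=> Frat Unear Feq.
have [P [Q PQ]] := @common_denominator _ (fun ij x => F x ij.1 ij.2)
  (fun ij => Frat ij.1 ij.2).
have [hD hD0 hDP] := near_and Unear PQ.
have [d dI] := distinct_elements k N.
have [u u0] := gr_eval_surj (diag_mx d) Xx0.
have [v v0] := choice (fun i : 'I_N =>
  gr_eval_surj (\matrix_(a, b) (a == i)%:R : 'M[k]_N) Xx0).
have [t0 t0E] := choice (fun j : 'I_N => gr_eval_surj (delta_mx 0 j : 'M[k]_N) Xx0).
have eig0 s : gr_eval x0 u *m delta_mx s (0 : 'I_1) = d 0 s *: delta_mx s 0.
  rewrite u0; apply/colP => a; rewrite mxE (bigD1 s) //= big1 ?addr0 => [|r rs].
    rewrite !mxE !eqxx mulr1 andbT.
    by case: eqP => [->|_]; rewrite ?mulr1n ?mulr1 // mulr0n mulr0.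
  by rewrite !mxE (negPf rs) mulr0.
(* v_i(x0) has ones in row i and zeros elsewhere, so v_i(x0) e_s = e_i. *)
have frame0 s : frame v x0 (delta_mx s 0) = 1%:M.
  apply/matrixP => a i; rewrite mxE v0 mxE (bigD1 s) //= big1 ?addr0 => [|r rs].
    by rewrite !mxE !eqxx mulr1.
  by rewrite !mxE (negPf rs) mulr0.
pose w := split_basis u v.
(* Row i of v_i(x0) u(x0)^l is (d_s^l)_s, so independence is a Vandermonde
   determinant. *)
have wU : coord_mx w x0 \in unitmx.
  rewrite unitmxE unitfE; apply/det0P => -[c c0 e].
  have {}e : \sum_j c 0 j *: gr_eval x0 (w j) = 0.
    apply: (can_inj mxvecK); rewrite linear0 -[RHS]e mulmx_sum_row linear_sum.
    by apply: eq_bigr => j _; rewrite rowK linearZ.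
  suff : vec_mx c *m Vandermonde N d = 0.
    have VU : Vandermonde N d \in unitmx.
      rewrite unitmxE unitfE det_Vandermonde; apply/prodf_neq0 => i _.
      apply/prodf_neq0 => j ij; rewrite subr_eq0 (inj_eq dI).
      by apply: contraTneq ij => ->; rewrite ltnn.
    move/(congr1 (mulmx^~ (invmx (Vandermonde N d)))); rewrite mul0mx mulmxK //.
    by move/(congr1 mxvec); rewrite vec_mxK linear0 => /eqP; rewrite (negPf c0).
  apply/matrixP => a s.
  have := split_basis_eigen v (fun j => c 0 j) (eig0 s).
  rewrite e mul0mx frame0 mul1mx => /colP /(_ a); rewrite [RHS]mxE => E.
  transitivity ((0 : 'cV[k]_N) a 0); last by rewrite !mxE.
  rewrite E mxE.
  by apply: eq_bigr => l _; rewrite !mxE.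
have [delta [dC d0 expand]] := central_expansion Xx0 wU.
have [phi phiP] : exists phi : 'I_m -> 'I_N -> 'I_(N * N) -> pt -> k, forall h j,
    (forall i, central_fun x0 (phi h j i)) /\
    near x0 (fun x => delta x *: gr_eval x (generator k n h * v j) =
      \sum_i phi h j i x *: gr_eval x (w i)).
  have H hj : exists f : 'I_(N * N) -> pt -> k, (forall i, central_fun x0 (f i)) /\
      near x0 (fun x => delta x *: gr_eval x (generator k n hj.1 * v hj.2) =
        \sum_i f i x *: gr_eval x (w i)).
    by have [f fC fH] := expand (generator k n hj.1 * v hj.2); exists f.
  by have [f fP] := choice H; exists (fun h j => f (h, j)) => h j; apply: (fP (h, j)).
have phiN : near x0 (fun x => forall h j, delta x *: gr_eval x (generator k n h * v j) =
      \sum_i phi h j i x *: gr_eval x (w i)).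
  by apply: near_all => h; apply: near_all => j; have [] := phiP h j.
pose y := split_point delta phi.
have y0 s : y x0 (d 0 s) = x0.
  apply/funext => h; have := frame_split_point (h := h) d0 (near_at Xx0 phiN h) (eig0 s).
  by rewrite frame0 mulmx1 mul1mx.
have eigY R : eigen_scalar X x0 u (fun x lambda => peval (y x lambda) R).
  apply: eigen_scalar_poly => h i j; rewrite /y /split_point.
  apply: (eigen_repr_ext (nu := fun x lambda b =>
    (\sum_(l < N) phi h j (mxvec_index i l) x * (delta x)^-1 * lambda ^+ l) *: b)).
    by move=> x lambda b; rewrite mxE.
  apply: eigen_scalar_sum => l; apply: eigen_scalar_mul; last first.
    by apply: eigen_scalar_exp; apply: eigen_scalar_var.
  apply: eigen_scalar_mul; last exact: eigen_scalar_inv.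
  by apply: eigen_scalar_central; have [] := phiP h j.
have eval0 R A psi : (forall lambda (b : 'cV[k]_N), gr_eval x0 u *m b = lambda *: b ->
    gr_eval x0 A *m b = psi *: (peval (y x0 lambda) R *: b)) ->
    gr_eval x0 A = (psi * peval x0 R)%:M.
  move=> H; apply/matrixP => a s; have := H _ _ (eig0 s).
  rewrite y0 scalerA -colE => /colP /(_ a); rewrite !mxE eqxx andbT => ->.
  by rewrite mulr_natr.
(* hA represents the equation hD of the bad locus, qA the common denominator Q
   and nA j the j-th column of the numerators of F, carried back by the frame. *)
have [hA [hphi [hC h0 hH]]] := eigY hD.
have [qA [qphi [qC q0 qH]]] := eigY Q.
have Q0 : peval x0 Q != 0 by have [_ []] := hDP x0 Xx0 hD0.
have hA0 := eval0 _ _ _ (near_at Xx0 hH).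
have qA0 := eval0 _ _ _ (near_at Xx0 qH).
have nP0 j : eigen_repr X x0 u (fun x lambda b =>
    \sum_i peval (y x lambda) (P (i, j)) *: (gr_eval x (v i) *m b)).
  by apply: eigen_repr_sum => i; apply: eigen_repr_scale => //; apply: eigen_repr_elt.
have [nA nP] := choice nP0.
have [psi {}nP] := choice nP.
have psiC j : central_fun x0 (psi j) by have [] := nP j.
have psi0 j : psi j x0 != 0 by have [] := nP j.
have nN : near x0 (fun x => forall j lambda (b : 'cV[k]_N),
      gr_eval x u *m b = lambda *: b -> gr_eval x (nA j) *m b =
        psi j x *: \sum_i peval (y x lambda) (P (i, j)) *: (gr_eval x (v i) *m b)).
  by apply: near_all => j; have [] := nP j.
have [c cP] := choice psiC; have [c0 c0P] := qC.
(* The factors t0 j combine the columns so that A is scalar at x0. *)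
pose A := \sum_j v j * qA * c j * ((psi j x0)^-1 *: t0 j).
pose B := \sum_j c0 * nA j * ((psi j x0)^-1 *: t0 j).
have FAB : near x0 (fun x => F x * gr_eval x A = gr_eval x B).
  have hAU : near x0 (fun x => gr_eval x hA \in unitmx).
    apply: near_unit; rewrite hA0 unitmxE det_scalar unitrX // unitfE mulf_neq0 //.
  have uN : near x0 (fun x => spectral_det (gr_eval x u) != 0).
    exists (spectral_det (gr_val u)) => [|x _]; last by rewrite -spectral_det_map.
    by rewrite -spectral_det_map -/(gr_eval x0 u) u0 spectral_det_diag.
  have DN : near x0 (fun x => peval x hD != 0) by exists hD.
  apply: near_mono (near_and
    (near_and (near_and hAU (near_and uN DN))
       (near_and (near_and (central_near_neq0 Xx0 dC d0) (central_near_neq0 Xx0 hC h0))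
                 (near_and (near_coord_mx X wU) phiN)))
    (near_and (near_and hH qH) (near_and (near_and nN (near_all cP)) c0P))).
  move=> x Xx [[[xhA [xu xD]] [[xd xh] [xw xphi]]] [[xhH xqH] [[xn xc] xc0]]].
  suff E j : F x *m gr_eval x (v j * qA * c j) = gr_eval x (c0 * nA j).
    rewrite /A /B !raddf_sum /= mulr_sumr; apply: eq_bigr => j _.
    by rewrite [gr_eval x (_ * _ * _ * _)]rmorphM [in RHS]rmorphM /= mulrA -E mulmxE.
  apply: (eq_on_eigenvectors xu) => lambda b ub b0.
  have gU : frame v x b \in unitmx := frame_unit xw ub b0.
  have yE : y x lambda = tconj (invmx (frame v x b)) x.
    apply/funext => h; rewrite /tconj invmxK -!mulmxE.
    by rewrite -mulmxA (frame_split_point xd (xphi h) ub) mulKmx.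
  have Xy : nvar_set X (y x lambda).
    have [_ _ st] := nvar_n_variety X; rewrite yE; apply: st => //.
    by rewrite unitmx_inv.
  (* Otherwise hA(x), which is invertible, would kill b. *)
  have yD : peval (y x lambda) hD != 0.
    apply: contra_neq b0 => yD0; have := xhH _ _ ub.
    rewrite yD0 scale0r scaler0 => /(congr1 (mulmx (invmx (gr_eval x hA)))).
    by rewrite mulKmx // mulmx0.
  have [Ux _] := hDP x Xx xD; have [Uy [Qy PQy]] := hDP _ Xy yD.
  have Fy : F x *m frame v x b = frame v x b *m F (y x lambda).
    rewrite yE Feq ?unitmx_inv // -?yE // invmxK -!mulmxE.
    by rewrite !mulmxA mulmxV // mul1mx.
  have Fv : F x *m (gr_eval x (v j) *m b) =
      \sum_i F (y x lambda) i j *: (gr_eval x (v i) *m b).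
    apply/colP => a; have /matrixP /(_ a j) := Fy; rewrite mxE [in RHS]mxE => e.
    transitivity (\sum_r F x a r * frame v x b r j).
      by rewrite mxE; apply: eq_bigr => r _; rewrite [frame _ _ _ _ _]mxE.
    rewrite e summxE; apply: eq_bigr => i _.
    by rewrite [frame _ _ _ _ _]mxE [RHS]mxE mulrC.
  rewrite !rmorphM /= -!mulmxE -!mulmxA xc xc0 !mul_scalar_mx -!scalemxAr (xqH _ _ ub).
  rewrite (xn _ _ _ ub) -!scalemxAr Fv [RHS]scalerA mulrC -[RHS]scalerA.
  congr (_ *: (_ *: _)); rewrite scaler_sumr; apply: eq_bigr => i _.
  by rewrite scalerA (PQy (i, j)).
have A0 : gr_eval x0 A = (qphi x0 * peval x0 Q)%:M.
  rewrite /A raddf_sum /= -[RHS]scalemx1 -[1%:M]/(1 : 'M[k]_N).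
  have -> : (1 : 'M[k]_N) = \sum_j delta_mx j j.
    apply/matrixP => a b; rewrite summxE (bigD1 a) //= big1 ?addr0 => [|r ra].
      by rewrite !mxE eqxx eq_sym.
    by rewrite mxE eq_sym (negPf ra).
  rewrite scaler_sumr; apply: eq_bigr => j _.
  rewrite !rmorphM /= gr_evalZ t0E qA0 (near_at Xx0 (cP j)) -!mulmxE.
  rewrite mul_mx_scalar mul_mx_scalar -!scalemxAl -scalemxAr !scalerA.
  rewrite [psi j x0 * _]mulrC mulfK; last exact: psi0.
  congr (_ *: _).
  apply/matrixP => a b; rewrite v0 mxE (bigD1 0) //= big1 ?addr0 => [|r r0].
    by rewrite !mxE eqxx /= -natrM mulnb.
  by rewrite !mxE (negPf r0) mulr0.
have [b [e be]] := central_multiple A0 (mulf_neq0 q0 Q0).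
exists (B * b), e; apply: near_mono (near_and FAB be) => x _ [xF [z z0 [ez abz]]].
by exists z => //; split=> //; rewrite rmorphM /= -xF -mulrA abz ez.
Qed.

End Descent.

(** * Generic identities in the coordinate ring *)
Section AlgQuot.
Local Open Scope quotient_scope.
Variables (k : fieldType) (A : algType k) (I : twoSidedIdeal A).
Local Notation "'p' x" := (\pi_(algQuot I) x) (at level 10).

Lemma aq_pi_eq x y : p x = p y <-> x - y \in I.
Proof.
split=> [/eqP|xy]; first by rewrite piE Quotient.equivE.
by apply/eqP; rewrite piE Quotient.equivE.
Qed.

Lemma aq_piD x y : p (x + y) = p x + p y. Proof. exact: raddfD. Qed.
Lemma aq_piM x y : p (x * y) = p x * p y.
Proof. by rewrite -[RHS]/(aq_mul _ _) !piE. Qed.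
Lemma aq_pi1 : p 1 = 1. Proof. by rewrite -[RHS]/(aq_one _) !piE. Qed.
Lemma aq_piZ c x : p (c *: x) = c *: p x.
Proof. by rewrite -[RHS]/(aq_scale _ _) !piE. Qed.
End AlgQuot.

Section Generic.
Local Open Scope quotient_scope.
Variables (k : closedFieldType) (m n : nat) (X : irrNVariety k m n).
Local Notation N := n.+1.
Local Notation pt := (Defs.point k m n).
Local Notation G := (genericRing k m n).
Local Notation near := (near X).

Definition generically (P : pt -> Prop) : Prop :=
  exists2 U, dense_open X U & forall a, U a -> P a.

Lemma gen_mono (P Q : pt -> Prop) : (forall x, nvar_set X x -> P x -> Q x) ->
  generically P -> generically Q.
Proof.
move=> PQ [U dU HU]; exists U => // a Ua; apply: PQ (HU a Ua).
by have [oU _] := dU; apply: (open_in_sub oU).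
Qed.

Lemma gen_true (P : pt -> Prop) : (forall x, nvar_set X x -> P x) -> generically P.
Proof. by move=> HP; exists (nvar_set X); [exact: dense_openT | ]. Qed.

Lemma gen_and P Q : generically P -> generically Q -> generically (fun x => P x /\ Q x).
Proof.
move=> [U dU HU] [W dW HW]; exists (U `&` W); first exact: dense_openI.
by move=> a [/HU ? /HW].
Qed.

Lemma near_gen x0 P : nvar_set X x0 -> near x0 P -> generically P.
Proof.
by move=> Xx0 /(near_dense Xx0) [U dU HU]; exists U => // a /HU [].
Qed.

Lemma gen_near P : generically P ->
  exists2 x0, nvar_set X x0 & near x0 P.
Proof.
move=> [U [oU dU] HU]; have [X0 _] := nvar_irreducible X.
have [x [Ux Xx]] := dU _ (open_inT X) X0; exists x => //.
by apply: near_mono (near_open oU Ux) => a _ /HU.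
Qed.

Lemma gen_ex P : generically P -> exists2 x, nvar_set X x & P x.
Proof. by move=> /gen_near [x Xx /(near_at Xx) Px]; exists x. Qed.

Lemma gen_all (I : finType) (P : I -> pt -> Prop) :
  (forall i, generically (P i)) -> generically (fun x => forall i, P i x).
Proof.
move=> HP; suff H (s : seq I) : generically (fun x => forall i, i \in s -> P i x).
  by apply: gen_mono (H (enum I)) => x _ Hx i; apply: Hx; rewrite mem_enum.
elim: s => [|i s IH]; first exact: gen_true.
apply: gen_mono (gen_and (HP i) IH) => x _ [Hi Hs] j.
by rewrite inE => /orP [/eqP ->|/Hs].
Qed.

Lemma gr_eval_gen0 (p : G) : generically (fun x => gr_eval x p = 0) ->
  forall x, nvar_set X x -> gr_eval x p = 0.
Proof.
move=> H x Xx; apply/matrixP => i j; rewrite [RHS]mxE; apply/eqP.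
apply: contrapT => /negP ne0.
have : near x (fun y => gr_eval y p i j != 0).
  by exists (gr_val p i j) => [|y _]; move: ne0; rewrite !mxE.
move=> /(near_gen Xx) /(gen_and H) /gen_ex [y _ [-> ]].
by rewrite mxE eqxx.
Qed.

Lemma scalar_mx_comm (A : 'M[k]_N) : (forall B, A * B = B * A) -> is_scalar_mx A.
Proof.
move=> H; apply/is_scalar_mxP; exists (A 0 0); apply/matrixP => i j; rewrite !mxE.
have E a b c d : (A * delta_mx a b) c d = A c a *+ (b == d).
  rewrite mxE (bigD1 a) //= big1 ?addr0 => [|r ra].
    by rewrite mxE eqxx eq_sym mulr_natr.
  by rewrite mxE (negPf ra) mulr0.
have E' a b c d : (delta_mx a b * A) c d = A b d *+ (a == c).
  rewrite mxE (bigD1 b) //= big1 ?addr0 => [|r rb].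
    by rewrite mxE eqxx andbT eq_sym mulr_natl.
  by rewrite mxE (negPf rb) andbF mul0r.
have := congr1 (fun M : 'M[k]_N => M i 0) (H (delta_mx j 0)).
by rewrite E E' eqxx mulr1n eq_sym => ->.
Qed.

Local Notation R := (coordRing X).
Local Notation crev := (@cr_eval k m n X).
Implicit Types r s : R.

Lemma cr_evalE a (p : G) : nvar_set X a ->
  crev a (\pi_(algQuot (idealOf X)) p) = gr_eval a p.
Proof. exact: cr_eval_pi. Qed.

Lemma cr_pi r : exists p : G, r = \pi_(algQuot (idealOf X)) p.
Proof. by exists (repr (r : algQuot (idealOf X))); rewrite reprK. Qed.

Lemma cr_evalD a r s : nvar_set X a -> crev a (r + s) = crev a r + crev a s.
Proof.
move=> Xa; have [p ->] := cr_pi r; have [q ->] := cr_pi s.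
by rewrite -[_ + _ in LHS]aq_piD !cr_evalE // rmorphD.
Qed.

Lemma cr_evalM a r s : nvar_set X a -> crev a (r * s) = crev a r * crev a s.
Proof.
move=> Xa; have [p ->] := cr_pi r; have [q ->] := cr_pi s.
by rewrite -[_ * _ in LHS]aq_piM !cr_evalE // rmorphM.
Qed.

Lemma cr_eval1 a : nvar_set X a -> crev a (1 : R) = 1.
Proof. by move=> Xa; rewrite -[1 in LHS]aq_pi1 cr_evalE // rmorph1. Qed.

Lemma cr_evalZ a c r : nvar_set X a -> crev a (c *: r) = c *: crev a r.
Proof.
move=> Xa; have [p ->] := cr_pi r.
by rewrite -[_ *: _ in LHS]aq_piZ !cr_evalE // gr_evalZ.
Qed.

Lemma cr_eval0 a : nvar_set X a -> crev a (0 : R) = 0.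
Proof. by move=> Xa; rewrite -(scale0r (0 : R)) cr_evalZ // scale0r. Qed.

Lemma cr_eval_ext r s : generically (fun a => crev a r = crev a s) -> r = s.
Proof.
have [p ->] := cr_pi r; have [q ->] := cr_pi s => H.
apply/aq_pi_eq; apply/asboolP; apply: gr_eval_gen0.
by apply: gen_mono H => x Xx; rewrite !cr_evalE // rmorphB /= => ->; rewrite subrr.
Qed.

Lemma cr_eval_surj x (M : 'M[k]_N) : nvar_set X x -> exists r, crev x r = M.
Proof.
move=> Xx; have [p pM] := gr_eval_surj M Xx.
by exists (\pi_(algQuot (idealOf X)) p); rewrite cr_evalE.
Qed.

(** The values at each point fill the matrix algebra, so a central element has
    scalar values; conversely, commuting on a dense open subset suffices. *)
Lemma center_coordRing c : center c <-> generically (fun x => is_scalar_mx (crev x c)).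
Proof.
split=> [cc|H r].
  apply: gen_true => x Xx; apply: scalar_mx_comm => B.
  by have [r <-] := cr_eval_surj B Xx; rewrite -!cr_evalM // cc.
apply: cr_eval_ext; apply: gen_mono H => x Xx /is_scalar_mxP [z e].
by rewrite !cr_evalM // e -!mulmxE mul_scalar_mx mul_mx_scalar.
Qed.

Lemma center_scalar c x : center c -> nvar_set X x ->
  crev x c = (crev x c 0 0)%:M.
Proof.
move=> cc Xx; have /is_scalar_mxP [z ->] : is_scalar_mx (crev x c).
  apply: scalar_mx_comm => B.
  by have [r <-] := cr_eval_surj B Xx; rewrite -!cr_evalM // cc.
by rewrite mxE eqxx mulr1n.
Qed.

Lemma cr_neq0 r : r != 0 -> exists2 x, nvar_set X x & crev x r != 0.
Proof.
move=> r0; apply: contrapT => H; move/eqP: r0; apply; apply: cr_eval_ext.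
apply: gen_true => x Xx; rewrite cr_eval0 //; apply/eqP; apply: contrapT => /negP rx.
by apply: H; exists x.
Qed.

Lemma center_neq0 c : center c -> c != 0 ->
  generically (fun x => crev x c 0 0 != 0).
Proof.
move=> cc /cr_neq0 [x Xx c0].
have [p pE] := cr_pi c; rewrite pE in cc c0 *.
have n0 : gr_eval x p 0 0 != 0.
  rewrite -cr_evalE //; apply: contraNneq c0 => e.
  by rewrite (center_scalar cc Xx) e -scalemx1 scale0r.
apply: (near_gen Xx); exists (gr_val p 0 0) => [|y Xy]; first by move: n0; rewrite !mxE.
by rewrite cr_evalE // !mxE.
Qed.

End Generic.

(** * The algebra of equivariant rational maps *)
Section RMapsTheory.
Local Open Scope quotient_scope.
Variables (k : closedFieldType) (m n : nat) (X : irrNVariety k m n) (V : matAlgebra k n).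
Local Notation pt := (Defs.point k m n).
Local Notation generically := (generically X).
Local Notation RM := (RMaps X V).
Local Notation rmf := (@rm_fun k m n X V).
Local Notation pir f := (\pi_(algQuot (rf_null_ideal X V)) f : RM).
Implicit Types (F H : RM) (f g : ratFun X V).

Lemma rm_pi F : exists f, F = pir f.
Proof. by exists (repr (F : algQuot (rf_null_ideal X V))); rewrite reprK. Qed.

Lemma rm_pi_eq f g : pir f = pir g <-> generically (fun a => rf_val f a = rf_val g a).
Proof.
have E a : rf_val (f - g) a = rf_val f a - rf_val g a by [].
split=> [/aq_pi_eq /asboolP [U dU HU]|[U dU HU]].
  by exists U => // a /HU; rewrite E => /eqP; rewrite subr_eq0 => /eqP.
apply/aq_pi_eq; apply/asboolP; exists U => // a /HU e.
by rewrite E e subrr.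
Qed.

Lemma rm_fun_pi f : generically (fun a => rmf (pir f) a = rf_val f a).
Proof. by apply/rm_pi_eq; rewrite reprK. Qed.

Lemma rm_fun_ext F H : generically (fun a => rmf F a = rmf H a) -> F = H.
Proof.
move=> e; rewrite -[F](reprK (F : algQuot (rf_null_ideal X V))).
by rewrite -[H](reprK (H : algQuot (rf_null_ideal X V))); apply/rm_pi_eq.
Qed.

Lemma rm_funD F H : generically (fun a => rmf (F + H) a = rmf F a + rmf H a).
Proof.
have [f ->] := rm_pi F; have [g ->] := rm_pi H; rewrite -[_ + _ in X in rmf X]aq_piD.
apply: gen_mono (gen_and (rm_fun_pi (f + g)) (gen_and (rm_fun_pi f) (rm_fun_pi g))).
by move=> a _ [-> [-> ->]].
Qed.

Lemma rm_funM F H : generically (fun a => rmf (F * H) a = rmf F a * rmf H a).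
Proof.
have [f ->] := rm_pi F; have [g ->] := rm_pi H; rewrite -[_ * _ in X in rmf X]aq_piM.
apply: gen_mono (gen_and (rm_fun_pi (f * g)) (gen_and (rm_fun_pi f) (rm_fun_pi g))).
by move=> a _ [-> [-> ->]].
Qed.

Lemma rm_fun1 : generically (fun a => rmf 1 a = 1).
Proof. by rewrite -[1 in X in rmf X]aq_pi1; apply: rm_fun_pi. Qed.

Lemma rm_funZ c F : generically (fun a => rmf (c *: F) a = c *: rmf F a).
Proof.
have [f ->] := rm_pi F; rewrite -[_ *: _ in X in rmf X]aq_piZ.
apply: gen_mono (gen_and (rm_fun_pi (c *: f)) (rm_fun_pi f)).
by move=> a _ [-> ->].
Qed.

Lemma rm_fun0 : generically (fun a => rmf 0 a = 0).
Proof.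
by rewrite -(scale0r (0 : RM)); apply: gen_mono (rm_funZ 0 0) => a _ ->; rewrite scale0r.
Qed.

Lemma rm_fun_sum (I : Type) (r : seq I) (F_ : I -> RM) :
  generically (fun a => rmf (\sum_(i <- r) F_ i) a = \sum_(i <- r) rmf (F_ i) a).
Proof.
elim: r => [|i r IH].
  by rewrite big_nil; apply: gen_mono rm_fun0 => a _ ->; rewrite big_nil.
rewrite big_cons; apply: gen_mono (gen_and IH (rm_funD (F_ i) (\sum_(j <- r) F_ j))).
by move=> a _ [e ->]; rewrite e big_cons.
Qed.

Lemma rm_fun_rational F : equivariant_rational X (rmf F).
Proof. exact: rf_valP. Qed.

Lemma rm_fun_exists (f : pt -> V) : equivariant_rational X f ->
  exists F, generically (fun a => rmf F a = f a).
Proof. by move=> rf; exists (pir (RatFun rf)); apply: rm_fun_pi. Qed.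

End RMapsTheory.

Section MatrixMaps.
Local Open Scope quotient_scope.
Variables (k : closedFieldType) (m n : nat) (X : irrNVariety k m n).
Local Notation N := n.+1.
Local Notation pt := (Defs.point k m n).
Local Notation G := (genericRing k m n).
Local Notation generically := (generically X).
Local Notation R := (coordRing X).
Local Notation crev := (@cr_eval k m n X).
Local Notation RMx := (RMapsMx X).
Local Notation rmf := (@rm_fun k m n X (conjMx k n)).

Definition mx_entry (i j : 'I_N) (M : 'M[k]_N) : k := M i j.
Lemma mx_entry_linear i j : scalable_for *%R (mx_entry i j).
Proof. by move=> c M; rewrite /mx_entry mxE. Qed.
Lemma mx_entry_zmod i j : zmod_morphism (mx_entry i j).
Proof. by move=> c M; rewrite /mx_entry !mxE. Qed.
HB.instance Definition _ i j := GRing.isZmodMorphism.Build _ _ _ (mx_entry_zmod i j).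
HB.instance Definition _ i j := GRing.isScalable.Build _ _ _ _ _ (mx_entry_linear i j).

Lemma regular_mx U (f : pt -> 'M[k]_N) : U `<=` nvar_set X ->
  (forall i j, regular_fun X U (fun a => f a i j)) ->
  regular_map (V := conjMx k n) X U f.
Proof.
move=> UX Hf l; have -> : (fun a => l (f a)) =
   fun a => \sum_i \sum_j f a i j * l (delta_mx i j).
  apply/funext => a; rewrite {1}(matrix_sum_delta (f a)) linear_sum.
  apply: eq_bigr => i _; rewrite linear_sum; apply: eq_bigr => j _.
  by rewrite linearZ.
apply: regular_fun_sum => // i; apply: regular_fun_sum => // j.
by apply: regular_funM => //; apply: regular_fun_cst.
Qed.

Lemma cr_eval_conj g x (r : R) : g \in unitmx -> nvar_set X x ->
  crev (tconj g x) r = g * crev x r * invmx g.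
Proof.
move=> gU Xx; have [p ->] := cr_pi r; rewrite !cr_evalE ?gr_eval_conj //.
by have [_ _ st] := nvar_n_variety X; apply: st.
Qed.

Lemma scalar_locus_dense (c : R) : center c -> c != 0 ->
  dense_open X [set a | nvar_set X a /\ crev a c 0 0 != 0].
Proof.
move=> cc c0; have [p pE] := cr_pi c; have [U [oU dU] HU] := center_neq0 cc c0.
pose Z := [set x : pt | forall q, [set gr_val p 0 0] q -> peval x q = 0].
split.
  exists Z; first by exists [set gr_val p 0 0].
  apply/seteqP; split=> a /= [Xa Ha]; split=> //.
    by move=> /(_ _ erefl); apply/eqP; move: Ha; rewrite pE cr_evalE // mxE.
  apply: contra_notN Ha => /eqP + q ->.
  by rewrite pE cr_evalE // mxE.
move=> W oW /(dU W oW) [a [Ua Wa]]; exists a; split=> //.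
by split; [exact: (open_in_sub oW) | exact: HU].
Qed.

Lemma frac_regular (p c : R) i j :
  regular_fun X [set a | nvar_set X a /\ crev a c 0 0 != 0]
     (fun a => crev a p i j / crev a c 0 0).
Proof.
move=> a [Xa _]; have [p' ->] := cr_pi p; have [c' ->] := cr_pi c.
exists (nvar_set X), (gr_val p' i j), (gr_val c' 0 0); split=> //; first exact: open_inT.
by move=> b [Xb]; rewrite !cr_evalE // !mxE.
Qed.

(** The denominator is a scalar invariant function, so the quotient is
    equivariant on the open subset where c does not vanish. *)
Lemma frac_exists (p c : R) : center c -> c != 0 ->
  exists F : RMx, generically (fun a => rmf F a = (crev a c 0 0)^-1 *: crev a p).
Proof.
move=> cc c0; apply: rm_fun_exists; apply/asboolP.
exists [set a | nvar_set X a /\ crev a c 0 0 != 0]; split.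
- exact: scalar_locus_dense.
- apply: regular_mx => [a []//|i j]; have := @frac_regular p c i j.
  congr regular_fun; apply/funext => a; by rewrite mulrC [RHS]mxE.
- move=> g a gU [Xa ca] [_ _]; rewrite [RHS]/(_ * _ * _) /= !cr_eval_conj //.
  rewrite (center_scalar cc Xa) -!mulmxE mul_mx_scalar -scalemxAl mulmxV // scalemx1.
  by rewrite mxE eqxx mulr1n -scalemxAr -scalemxAl.
Qed.

Lemma center1 (A : nzRingType) : center (1 : A).
Proof. by move=> a; rewrite mul1r mulr1. Qed.

Lemma emb_exists (p : R) : exists F : RMx, generically (fun a => rmf F a = crev a p).
Proof.
have [F HF] := frac_exists p (@center1 R) (oner_neq0 R); exists F.
by apply: gen_mono HF => a Xa ->; rewrite cr_eval1 // mxE eqxx invr1 scale1r.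
Qed.

Definition emb (p : R) : RMx := sval (cid (emb_exists p)).

Lemma embE p : generically (fun a => rmf (emb p) a = crev a p).
Proof. exact: (svalP (cid (emb_exists p))). Qed.

Lemma embM p q : emb (p * q) = emb p * emb q.
Proof.
apply: rm_fun_ext; apply: gen_mono (gen_and (gen_and (embE p) (embE q))
  (gen_and (embE (p * q)) (rm_funM (emb p) (emb q)))).
by move=> a Xa [[e1 e2] [-> ->]]; rewrite e1 e2 cr_evalM.
Qed.

Lemma embD p q : emb (p + q) = emb p + emb q.
Proof.
apply: rm_fun_ext; apply: gen_mono (gen_and (gen_and (embE p) (embE q))
  (gen_and (embE (p + q)) (rm_funD (emb p) (emb q)))).
by move=> a Xa [[e1 e2] [-> ->]]; rewrite e1 e2 cr_evalD.
Qed.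

Lemma embZ c p : emb (c *: p) = c *: emb p.
Proof.
apply: rm_fun_ext; apply: gen_mono (gen_and (embE p)
  (gen_and (embE (c *: p)) (rm_funZ c (emb p)))).
by move=> a Xa [e1 [-> ->]]; rewrite e1 cr_evalZ.
Qed.

Lemma emb1 : emb 1 = 1.
Proof.
apply: rm_fun_ext; apply: gen_mono (gen_and (embE 1) (rm_fun1 X (conjMx k n))).
by move=> a Xa [-> ->]; rewrite cr_eval1.
Qed.

Lemma emb0 : emb 0 = 0.
Proof. by rewrite -(scale0r (0 : R)) embZ scale0r. Qed.

Lemma emb_inj : injective emb.
Proof.
move=> p q e; apply: cr_eval_ext; apply: gen_mono (gen_and (embE p) (embE q)).
by move=> a _ [<- <-]; rewrite e.
Qed.

Lemma emb_center_comm c (F : RMx) : center c -> emb c * F = F * emb c.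
Proof.
move=> cc; apply: rm_fun_ext.
apply: gen_mono (gen_and (embE c) (gen_and (rm_funM (emb c) F) (rm_funM F (emb c)))).
move=> a Xa [e [-> ->]]; rewrite e (center_scalar cc Xa).
by rewrite -!mulmxE mul_scalar_mx mul_mx_scalar.
Qed.

Lemma emb_center_inv c : center c -> c != 0 -> exists C : RMx, C * emb c = 1.
Proof.
move=> cc c0; have [C HC] := frac_exists 1 cc c0; exists C; apply: rm_fun_ext.
apply: gen_mono (gen_and (gen_and (embE c) HC)
  (gen_and (rm_funM C (emb c)) (gen_and (rm_fun1 X (conjMx k n)) (center_neq0 cc c0)))).
move=> a Xa [[e1 e2] [-> [-> c0a]]]; rewrite e1 e2 cr_eval1 // (center_scalar cc Xa).
by rewrite -scalerAl mul1r mxE eqxx mulr1n scale_scalar_mx mulVf.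
Qed.

(** The local fractions given by [descent] near a point of the domain of F are
    global ones, since identities that hold near a point hold generically. *)
Lemma rational_descent (F : RMx) :
  exists p c : R, [/\ center c, c != 0 & F * emb c = emb p].
Proof.
have /asboolP [U [[oU dU] rU eU]] := rm_fun_rational F.
have [X0 _] := nvar_irreducible X.
have [x0 [Ux Xx]] := dU _ (open_inT X) X0.
have rat i j : exists P Q : coordPoly k m n,
    near X x0 (fun x => peval x Q != 0 /\ rmf F x i j = peval x P / peval x Q).
  have [W [P [Q [oW Wx H]]]] := rU (mx_entry i j) x0 Ux.
  exists P, Q; apply: near_mono (near_and (near_open oU Ux) (near_open oW Wx)).
  by move=> x _ [Ux' Wx']; apply: H.
have [p [c H]] := descent Xx rat (near_open oU Ux) (fun g x gU => eU g x gU).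
have {}H := near_gen Xx H.
exists (\pi_(algQuot (idealOf X)) p), (\pi_(algQuot (idealOf X)) c); split.
- apply/center_coordRing; apply: gen_mono H => x Xx' [z _ [e _]].
  by rewrite cr_evalE // e scalar_mx_is_scalar.
- apply/eqP => c0; have [x Xx' [z z0 [e _]]] := gen_ex H.
  move: e; rewrite -(@cr_evalE _ _ _ X) // c0 cr_eval0 // => /matrixP /(_ 0 0).
  by rewrite !mxE eqxx mulr1n => /eqP; rewrite eq_sym (negPf z0).
apply: rm_fun_ext; apply: gen_mono (gen_and H (gen_and
  (gen_and (embE (\pi_(algQuot (idealOf X)) p)) (embE (\pi_(algQuot (idealOf X)) c)))
  (rm_funM F (emb (\pi_(algQuot (idealOf X)) c))))).
move=> x Xx' [[z z0 [e1 e2]] [[e3 e4] ->]].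
by rewrite e3 e4 !cr_evalE.
Qed.

End MatrixMaps.

(** * Simplicity and center of the algebra of equivariant maps *)
Section CenterOfRMaps.
Local Open Scope quotient_scope.
Variables (k : closedFieldType) (m n : nat) (X : irrNVariety k m n).
Local Notation N := n.+1.
Local Notation pt := (Defs.point k m n).
Local Notation generically := (generically X).
Local Notation R := (coordRing X).
Local Notation crev := (@cr_eval k m n X).
Local Notation RMx := (RMapsMx X).
Local Notation rmf := (@rm_fun k m n X (conjMx k n)).
Local Notation kX := (invRatFun X).
Local Notation invf := (@rm_fun k m n X (trivScalars k n)).
Local Notation emb := (@emb k m n X).

Lemma sigma_exists (f : kX) : exists F : RMx, generically (fun a => rmf F a = (invf f a)%:M).
Proof.
apply: rm_fun_exists; apply/asboolP.
have /asboolP [U [[oU dU] rU eU]] := rm_fun_rational f.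
exists U; split=> //.
- apply: regular_mx => [|i j]; first exact: open_in_sub.
  have -> : (fun a : pt => (invf f a)%:M i j) = fun a => invf f a * (i == j)%:R :> k.
    by apply/funext => a; rewrite mxE mulr_natr.
  apply: regular_funM; last by apply: regular_fun_cst; apply: open_in_sub.
  exact: (rU (idfun : {scalar k^o})).
- move=> g a gU Ua Uga; rewrite -[RHS]/(g *m (invf f a)%:M *m invmx g) mul_mx_scalar.
  by rewrite -scalemxAl mulmxV // scalemx1 (eU g a gU Ua Uga).
Qed.

Definition sigma (f : kX) : RMx := sval (cid (sigma_exists f)).

Lemma sigmaE f : generically (fun a => rmf (sigma f) a = (invf f a)%:M).
Proof. exact: (svalP (cid (sigma_exists f))). Qed.

Lemma sigma_linear c f g : sigma (c *: f + g) = c *: sigma f + sigma g.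
Proof.
apply: rm_fun_ext; apply: gen_mono (gen_and (gen_and (gen_and (sigmaE f) (sigmaE g))
   (gen_and (sigmaE (c *: f + g)) (gen_and (rm_funD (c *: f) g) (rm_funZ c f))))
  (gen_and (rm_funZ c (sigma f)) (rm_funD (c *: sigma f) (sigma g)))).
move=> a Xa [[[e1 e2] [-> [-> ->]]] [e3 ->]]; rewrite e3 e1 e2.
by rewrite scale_scalar_mx raddfD.
Qed.

Lemma sigma_mul f g : sigma (f * g) = sigma f * sigma g.
Proof.
apply: rm_fun_ext; apply: gen_mono (gen_and (gen_and (sigmaE f) (sigmaE g))
   (gen_and (gen_and (sigmaE (f * g)) (rm_funM f g)) (rm_funM (sigma f) (sigma g)))).
move=> a Xa [[e1 e2] [[-> ->] ->]]; rewrite e1 e2.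
by rewrite -mulmxE -scalar_mxM.
Qed.

Lemma sigma_one : sigma 1 = 1.
Proof.
apply: rm_fun_ext; apply: gen_mono (gen_and (sigmaE 1)
  (gen_and (rm_fun1 X (conjMx k n)) (rm_fun1 X (trivScalars k n)))).
by move=> a Xa [-> [-> ->]].
Qed.

Lemma sigma_zmod : zmod_morphism sigma.
Proof. by move=> f g; rewrite addrC -scaleN1r sigma_linear scaleN1r addrC. Qed.
Lemma sigma_scalable : scalable sigma.
Proof.
move=> c f; have s0 : sigma 0 = 0 by rewrite -(subrr 0) sigma_zmod subrr.
by rewrite -[c *: f]addr0 sigma_linear s0 addr0.
Qed.
Lemma sigma_monoid : monoid_morphism sigma.
Proof. by split; [exact: sigma_one | exact: sigma_mul]. Qed.
HB.instance Definition _ := GRing.isZmodMorphism.Build kX RMx sigma sigma_zmod.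
HB.instance Definition _ := GRing.isScalable.Build k kX RMx _ sigma sigma_scalable.
HB.instance Definition _ := GRing.isMonoidMorphism.Build kX RMx sigma sigma_monoid.

Lemma sigma_inj : injective sigma.
Proof.
move=> f g e; apply: rm_fun_ext.
apply: gen_mono (gen_and (sigmaE f) (sigmaE g)) => a _ [].
rewrite e => -> /matrixP /(_ 0 0); rewrite !mxE eqxx !mulr1n => ->.
by [].
Qed.

Lemma scalar_center (F : RMx) : generically (fun a => is_scalar_mx (rmf F a)) -> center F.
Proof.
move=> HF H; apply: rm_fun_ext.
apply: gen_mono (gen_and HF (gen_and (rm_funM F H) (rm_funM H F))).
move=> a _ [/is_scalar_mxP [z e] [-> ->]].
by rewrite e -!mulmxE mul_scalar_mx mul_mx_scalar.
Qed.

Lemma center_descent (F : RMx) : center F -> exists p c : R,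
  [/\ center p, center c, c != 0 & F * emb c = emb p].
Proof.
move=> cF; have [p [c [cc c0 Fc]]] := rational_descent F; exists p, c; split=> //.
move=> r; apply: emb_inj; rewrite !embM -Fc.
by rewrite -mulrA (emb_center_comm _ cc) mulrA cF mulrA.
Qed.

(** A central map is p / c with p and c central, so it is the scalar map of the
    invariant function that is the quotient of their scalar values. *)
Lemma range_sigma : range sigma = @center RMx.
Proof.
apply/seteqP; split=> [_ [f _ <-]|F cF].
  apply: scalar_center; apply: gen_mono (sigmaE f) => a _ ->.
  exact: scalar_mx_is_scalar.
have [p [c [cp cc c0 Fc]]] := center_descent cF.
have [f fE] : exists f : kX, generically (fun a => invf f a = crev a p 0 0 / crev a c 0 0).
  apply: rm_fun_exists; apply/asboolP.
  exists [set a | nvar_set X a /\ crev a c 0 0 != 0]; split.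
  - exact: scalar_locus_dense.
  - move=> l; have -> : (fun a => l (crev a p 0 0 / crev a c 0 0)) =
      fun a => crev a p 0 0 / crev a c 0 0 * l 1.
      by apply/funext => a; rewrite -linearZ /= [_ *: _]mulr1.
    apply: regular_funM; first exact: frac_regular.
    by apply: regular_fun_cst => a [].
  - move=> g a gU [Xa _] _ /=; rewrite !cr_eval_conj //.
    rewrite (center_scalar cc Xa) (center_scalar cp Xa) -!mulmxE !mul_mx_scalar.
    by rewrite -!scalemxAl mulmxV // !scalemx1.
exists f => //; apply: rm_fun_ext; have [C CE] := emb_center_inv cc c0.
apply: gen_mono (gen_and (gen_and fE (sigmaE f)) (gen_and (gen_and (embE p) (embE c))
   (gen_and (rm_funM F (emb c)) (center_neq0 cc c0)))).
move=> a Xa [[e1 e2] [[e3 e4] [e5 n0]]]; rewrite e2 e1.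
have e6 : rmf F a *m crev a c = crev a p by rewrite -e4 -e3 -Fc e5.
rewrite (center_scalar cc Xa) (center_scalar cp Xa) mul_mx_scalar in e6.
by rewrite mulrC -scale_scalar_mx -e6 scalerA mulVf ?scale1r.
Qed.

(** A nonzero element of an ideal J has a multiple p in J coming from k_n[X].
    The Casimir operator at a point where some z p has nonzero trace sends z p
    to a nonzero central element d of J, and d is invertible. *)
Lemma RMaps_simple : simple_ring RMx.
Proof.
move=> J J0 JD JM; have [J1|nJ] := pselect (J 1).
  right; apply/seteqP; split=> // F _; rewrite -[F]mulr1.
  by have [] := JM F 1 J1.
left; apply/seteqP; split=> [F JF|_ ->] //; apply: contrapT => F0; apply: nJ.
have [p [c [cc c0 Fc]]] := rational_descent F; have [C CE] := emb_center_inv cc c0.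
have Jp : J (emb p) by rewrite -Fc; have [] := JM (emb c) F JF.
have p0 : p != 0.
  apply/eqP => e; apply: F0; rewrite /set1 /= -[F]mulr1 -CE.
  have -> : F * (C * emb c) = F * emb c * C.
    by rewrite -(emb_center_comm C cc) mulrA.
  by rewrite Fc e emb0 mul0r.
have [x Xx px0] := cr_neq0 p0.
have [z zE] : exists z : R, \tr (crev x (z * p)) != 0.
  have [i [j pij]] : exists i j, crev x p i j != 0.
    apply: contrapT => H; move/eqP: px0; apply; apply/matrixP => i j; rewrite [RHS]mxE.
    by apply: contrapT => /eqP pij; apply: H; exists i, j.
  have [z zE] := cr_eval_surj (delta_mx j i) Xx; exists z.
  rewrite cr_evalM // zE /mxtrace (bigD1 j) //= big1 ?addr0 => [|a aj].
    rewrite mxE (bigD1 i) //= big1 ?addr0 => [|b bi].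
      by rewrite mxE !eqxx mul1r.
    by rewrite mxE (negPf bi) andbF mul0r.
  by rewrite mxE big1 // => b _; rewrite mxE (negPf aj) mul0r.
have [s [sN s0]] := casimir Xx.
pose pir (g : genericRing k m n) : R := \pi_(algQuot (idealOf X)) g.
pose d : R := sandwich [seq (pir ab.1, pir ab.2) | ab <- s] (z * p).
have dE a : nvar_set X a ->
    crev a d = sandwich [seq ev_pair a ab | ab <- s] (crev a (z * p)).
  move=> Xa; rewrite /d /sandwich; elim: (s) => [|ab r IH] /=.
    by rewrite !big_nil cr_eval0.
  by rewrite !big_cons cr_evalD // IH !cr_evalM // !cr_evalE.
have cd : center d.
  apply/center_coordRing; apply: gen_mono (near_gen Xx sN) => a Xa H.
  by rewrite dE.
have d0 : d != 0.
  apply/eqP => e; have := dE x Xx; rewrite e cr_eval0 // s0 => /matrixP /(_ 0 0).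
  by rewrite !mxE eqxx mulr1n => /eqP; rewrite eq_sym (negPf zE).
have Jd : J (emb d).
  rewrite /d /sandwich; elim: (s) => [|ab r IH] /=; first by rewrite big_nil emb0.
  rewrite big_cons embD; apply: JD IH; rewrite !embM.
  have Jzp : J (emb z * emb p) by have [] := JM (emb z) _ Jp.
  by apply: (JM _ _ _).2; apply: (JM _ _ _).1.
have [D <-] := emb_center_inv cd d0.
by have [] := JM D _ Jd.
Qed.

Lemma center_mul (A : nzRingType) (a b : A) : center a -> center b -> center (a * b).
Proof. by move=> ca cb r; rewrite -mulrA cb mulrA ca -mulrA. Qed.

Lemma inv_center (c : R) (C : RMx) : center c -> C * emb c = 1 -> center C.
Proof.
move=> cc CE H; have CE' : emb c * C = 1 by rewrite (emb_center_comm _ cc).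
by rewrite -[LHS]mulr1 -CE' mulrA -(mulrA C H) -(emb_center_comm H cc) mulrA CE mul1r.
Qed.

Lemma center_scalar_gen (F : RMx) : center F ->
  generically (fun a => rmf F a = (rmf F a 0 0)%:M).
Proof.
rewrite -[center F]/((@center RMx) F) -range_sigma => -[f _ <-].
by apply: gen_mono (sigmaE f) => a _ ->; rewrite mxE eqxx mulr1n.
Qed.

(** The basis consists of elements of k_n[X] whose values at a point x are the
    matrix units: they are a basis near x, which gives uniqueness, and
    [central_expansion] gives the coefficients, as central fractions. *)
Lemma RMaps_central_simple : central_simple_of_degree n.+1 RMx.
Proof.
split; first exact: RMaps_simple.
have [[x Xx] _] := nvar_irreducible X.
have [w wE] := choice (fun j : 'I_(N * N) => gr_eval_surj (vec_mx (delta_mx 0 j)) Xx).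
pose pir (g : genericRing k m n) : R := \pi_(algQuot (idealOf X)) g.
have wU : coord_mx w x \in unitmx.
  have -> : coord_mx w x = 1%:M; last exact: unitmx1.
  by apply/row_matrixP => i; rewrite rowK wE vec_mxK row1.
exists (fun j : 'I_(N ^ 2) => emb (pir (w j))) => F.
have [p [c [cc c0 Fc]]] := rational_descent F; have [p' pE] := cr_pi p.
have [delta [[d dN] d0 /(_ p') [phi phiC phiN]]] := central_expansion Xx wU.
have [q qN] := choice phiC; have dx := near_at Xx dN.
have cd : center (pir d).
  apply/center_coordRing; apply: gen_mono (near_gen Xx dN) => a Xa e.
  by rewrite cr_evalE // e scalar_mx_is_scalar.
have pd0 : pir d != 0.
  apply: contraNneq d0 => e; move: dx; rewrite -(@cr_evalE _ _ _ X) // -/(pir d) e.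
  by rewrite cr_eval0 // => /matrixP /(_ 0 0); rewrite !mxE eqxx mulr1n => <-.
have cq i : center (pir (q i)).
  apply/center_coordRing; apply: gen_mono (near_gen Xx (qN i)) => a Xa e.
  by rewrite cr_evalE // e scalar_mx_is_scalar.
have expand : pir d * p = \sum_i pir (q i) * pir (w i).
  rewrite pE -[LHS]aq_piM; under eq_bigr => i _ do rewrite -[_ * _]aq_piM.
  rewrite -raddf_sum; apply: cr_eval_ext.
  apply: gen_mono (near_gen Xx (near_and dN (near_and phiN (near_all qN)))).
  move=> a Xa [ed [e eq]]; rewrite !cr_evalE // raddf_sum rmorphM /= ed -mulmxE.
  rewrite mul_scalar_mx e; apply: eq_bigr => i _.
  by rewrite rmorphM /= eq -mulmxE mul_scalar_mx.
have [C CE] := emb_center_inv cc c0; have [D DE] := emb_center_inv cd pd0.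
have cC := inv_center cc CE; have cD := inv_center cd DE.
have cz i : center (D * C * emb (pir (q i))).
  by apply: center_mul; [apply: center_mul | move=> H; apply: emb_center_comm].
have FE : F = \sum_i D * C * emb (pir (q i)) * emb (pir (w i)).
  under eq_bigr => i _ do rewrite -mulrA -embM.
  rewrite -mulr_sumr -(big_morph emb (@embD k m n X) (emb0 X)) -expand embM -Fc.
  rewrite -mulrA (cC (emb (pir d) * _)) !mulrA DE mul1r.
  by rewrite -mulrA -(cC (emb c)) CE mulr1.
exists [ffun i => D * C * emb (pir (q i))]; split.
  by split=> [i|]; [rewrite ffunE | rewrite [LHS]FE; apply: eq_bigr => i _; rewrite ffunE].
have coef (z : {ffun 'I_(N ^ 2) -> RMx}) : (forall i, center (z i)) ->
    F = \sum_i z i * emb (pir (w i)) -> forall i,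
    generically (fun a => rmf (z i) a =
      ((mxvec (rmf F a) *m invmx (coord_mx w a)) 0 i)%:M).
  move=> zc zF i.
  have zN := gen_all (fun j => center_scalar_gen (zc j)).
  have zwN := gen_all (fun j => rm_funM (z j) (emb (pir (w j)))).
  have wN := gen_all (fun j => embE (pir (w j))).
  have sN := rm_fun_sum (index_enum 'I_(N ^ 2)) (fun j => z j * emb (pir (w j))).
  apply: gen_mono (gen_and (gen_and (near_gen Xx (near_coord_mx X wU)) zN)
                           (gen_and (gen_and zwN wN) sN)).
  move=> a Xa [[wa za] [[zwa ewa] sa]].
  pose zeta := \row_(j < N * N) rmf (z j) a 0 0.
  suff -> : mxvec (rmf F a) = zeta *m coord_mx w a by rewrite mulmxK // mxE -za.
  rewrite zF sa mulmx_sum_row linear_sum; apply: eq_bigr => j _.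
  rewrite rowK mxE -linearZ /= zwa ewa cr_evalE // za.
  by rewrite -mulmxE mul_scalar_mx mxE eqxx mulr1n.
move=> z [zc zF]; apply/ffunP => i; apply: rm_fun_ext.
apply: gen_mono (gen_and (coef z zc zF i) (coef [ffun j => D * C * emb (pir (q j))] _ _ i)).
- by move=> a _ [-> ->].
- by move=> j; rewrite ffunE.
- by rewrite [LHS]FE; apply: eq_bigr => j _; rewrite ffunE.
Qed.


End CenterOfRMaps.

(** * Regular elements of the coordinate ring *)
Section RegularElements.
Variables (k : closedFieldType) (m n : nat) (X : irrNVariety k m n).
Local Notation N := n.+1.
Local Notation pt := (Defs.point k m n).
Local Notation generically := (generically X).
Local Notation R := (coordRing X).
Local Notation crev := (@cr_eval k m n X).
Local Notation RMx := (RMapsMx X).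
Local Notation rmf := (@rm_fun k m n X (conjMx k n)).
Local Notation emb := (@emb k m n X).

Lemma invariant_poly_exists (P : coordPoly k m n) (f : pt -> k) :
  (forall a, nvar_set X a -> f a = peval a P) ->
  (forall g a, g \in unitmx -> nvar_set X a -> f (tconj g a) = f a) ->
  exists F : RMx, generically (fun a => rmf F a = (f a)%:M).
Proof.
move=> fP fI; apply: rm_fun_exists; apply/asboolP; exists (nvar_set X); split.
- exact: dense_openT.
- apply: regular_mx => // i j a Xa.
  exists (nvar_set X), (P *+ (i == j)), 1; split=> //; first exact: open_inT.
  move=> b Xb _; rewrite rmorph1 oner_neq0 divr1 mxE fP //.
  by case: (i == j); rewrite ?mulr1n // !mulr0n rmorph0.
- move=> g a gU Xa _; rewrite fI // -[RHS]/(g *m (f a)%:M *m invmx g).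
  by rewrite mul_mx_scalar -scalemxAl mulmxV // scalemx1.
Qed.

(** The theorem of Cayley and Hamilton, the coefficients of the characteristic
    polynomial being invariant under conjugation and therefore central. *)
Lemma char_poly_relation (s : R) : exists E : nat -> RMx,
  [/\ forall i, center (E i), E N = 1 & \sum_(i < N.+1) E i * emb s ^+ i = 0].
Proof.
have [s' sE] := cr_pi s.
have EX i : exists F : RMx,
    generically (fun a => rmf F a = ((char_poly (crev a s))`_i)%:M).
  apply: (@invariant_poly_exists (char_poly (gr_val s' : 'M_N))`_i) => [a Xa|g a gU Xa].
    by rewrite sE cr_evalE // -coef_map map_char_poly.
  rewrite cr_eval_conj // (char_poly_conj (D := crev a s) gU) //.
  by rewrite -!mulmxE mulmxKV.
have [E EP] := choice EX.
exists E; split.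
- move=> i; apply: scalar_center; apply: gen_mono (EP i) => a _ ->.
  exact: scalar_mx_is_scalar.
- apply: rm_fun_ext; apply: gen_mono (gen_and (EP N) (rm_fun1 X (conjMx k n))).
  move=> a _ [-> ->]; have := monicP (char_poly_monic (crev a s)).
  by rewrite /lead_coef size_char_poly /= => ->.
have XN := gen_all (fun i : 'I_N.+1 => embE (s ^+ i)).
have EN := gen_all (fun i : 'I_N.+1 => EP i).
have MN := gen_all (fun i : 'I_N.+1 => rm_funM (E i) (emb (s ^+ i))).
have SN := rm_fun_sum (index_enum 'I_N.+1) (fun i => E i * emb (s ^+ i)).
have embX i : emb (s ^+ i) = emb s ^+ i.
  by elim: i => [|i IH]; rewrite ?expr0 ?emb1 // !exprS embM IH.
rewrite (eq_bigr (fun i : 'I_N.+1 => E i * emb (s ^+ i))) => [|i _]; last by rewrite embX.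
apply: rm_fun_ext; apply: gen_mono (gen_and (gen_and XN EN)
  (gen_and (gen_and MN SN) (rm_fun0 X (conjMx k n)))).
move=> a Xa [[xa ea] [[ma ->] ->]].
transitivity (horner_mx (crev a s) (char_poly (crev a s))); last first.
  exact: Cayley_Hamilton.
have crX i : crev a (s ^+ i) = crev a s ^+ i.
  by elim: i => [|i IH]; rewrite ?expr0 ?cr_eval1 // !exprS cr_evalM // IH.
rewrite -[char_poly _]coefK poly_def size_char_poly raddf_sum /=.
apply: eq_bigr => i _; rewrite horner_mxZ rmorphXn /= horner_mx_X.
by rewrite ma ea xa crX -mulmxE mul_scalar_mx.
Qed.

(** The relation reads E_0 + T s = 0.  If E_0 is nonzero, -T is the multiplier
    sought.  Otherwise T s = 0; as T has a multiple in k_n[X] by an invertible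
    central element and s is regular there, T = 0 is a shorter relation. *)
Lemma central_multiple_of (s : R) (r : nat) (E : nat -> RMx) :
  regular_elt s -> (forall i, center (E i)) -> (exists2 i, (i < r)%N & E i != 0) ->
  \sum_(i < r) E i * emb s ^+ i = 0 ->
  exists T F : RMx, [/\ center F, F != 0 & T * emb s = F].
Proof.
move=> sR; elim: r E => [|r IH] E cE [i ir Ei]; first by [].
pose T := \sum_(i < r) E i.+1 * emb s ^+ i.
rewrite big_ord_recl expr0 mulr1 => rel.
have {}rel : E 0%N + T * emb s = 0.
  rewrite -[RHS]rel; congr (_ + _); rewrite mulr_suml; apply: eq_bigr => j _.
  by rewrite -mulrA -exprSr.
have [E0|E0] := eqVneq (E 0%N) 0; last first.
  exists (- T), (E 0%N); split=> //; rewrite mulNr.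
  by apply/eqP; rewrite eq_sym -addr_eq0 rel.
have T0 : T = 0.
  have [t [c [cc c0 Tc]]] := rational_descent T; have [C CE] := emb_center_inv cc c0.
  suff t0 : t = 0.
    have -> : T = T * emb c * C.
      by rewrite -mulrA (emb_center_comm _ cc) CE mulr1.
    by rewrite Tc t0 emb0 mul0r.
  have [_] := sR t; apply; apply: emb_inj; rewrite embM -Tc emb0.
  rewrite -mulrA (emb_center_comm _ cc) mulrA.
  by move: rel; rewrite E0 add0r => ->; rewrite mul0r.
apply: (IH (fun i => E i.+1)) => //.
case: i ir Ei => [|i] ir Ei; first by rewrite E0 eqxx in Ei.
by exists i.
Qed.

Lemma regular_central_multiple (s : R) : regular_elt s ->
  exists p c : R, [/\ center c, c != 0 & p * s = c].
Proof.
move=> sR; have [E [cE EN rel]] := char_poly_relation s.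
have [] := central_multiple_of sR cE _ rel.
  by exists N; rewrite // EN oner_neq0.
move=> T [F [cF F0 TF]].
have [t [c [cc c0 Tc]]] := rational_descent T.
have [f [d [cf cd d0 Fd]]] := center_descent cF.
have [C CE] := emb_center_inv cc c0; have [D DE] := emb_center_inv cd d0.
exists (t * d), (f * c); split.
- exact: center_mul.
- apply/eqP => /(congr1 emb); rewrite embM emb0 -Fd => e; move/eqP: F0; apply.
  have dD : emb d * D = 1 by rewrite (emb_center_comm _ cd).
  have cC : emb c * C = 1 by rewrite (emb_center_comm _ cc).
  rewrite -[F]mulr1 -dD -[D]mul1r -cC -[emb c * C * D]mulrA !mulrA e.
  by rewrite !mul0r.
apply: emb_inj; rewrite !embM -Tc -Fd -TF.
rewrite -!mulrA; congr (_ * _); rewrite (emb_center_comm _ cc).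
by rewrite (emb_center_comm _ cd) mulrA.
Qed.

End RegularElements.

(** * The embedding of the total ring of fractions *)
Section FractionRing.
Variables (k : closedFieldType) (m n : nat) (X : irrNVariety k m n).
Variables (Q : algType k) (iota : {lrmorphism coordRing X -> Q}).
Hypothesis Q_frac : total_ring_of_fractions iota.
Local Notation N := n.+1.
Local Notation generically := (generically X).
Local Notation R := (coordRing X).
Local Notation crev := (@cr_eval k m n X).
Local Notation RMx := (RMapsMx X).
Local Notation rmf := (@rm_fun k m n X (conjMx k n)).
Local Notation emb := (@emb k m n X).

Lemma center_regular (c : R) : center c -> c != 0 -> regular_elt c.
Proof.
move=> cc c0 a; suff H : c * a = 0 -> a = 0 by split=> //; rewrite -cc.
move=> ca; have [C CE] := emb_center_inv cc c0; apply: emb_inj.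
by rewrite emb0 -[emb a]mul1r -CE -mulrA -embM ca emb0 mulr0.
Qed.

Lemma iota_center_comm (c : R) (q : Q) : center c -> iota c * q = q * iota c.
Proof.
move=> cc; have [_ _ /(_ q) [a [s [t [_ st ts ->]]]]] := Q_frac.
have tc : iota c * t = t * iota c.
  rewrite -[iota c * t]mul1r -ts -!mulrA; congr (_ * _).
  by rewrite mulrA -rmorphM -cc rmorphM -mulrA st mulr1.
by rewrite mulrA -rmorphM cc rmorphM -!mulrA tc.
Qed.

Lemma central_denominator (q : Q) :
  exists p c : R, [/\ center c, c != 0 & q * iota c = iota p].
Proof.
have [_ _ /(_ q) [a [s [t [sR st ts qE]]]]] := Q_frac.
have [p [c [cc c0 psc]]] := regular_central_multiple sR.
exists (a * p), c; split=> //.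
rewrite qE -mulrA -(iota_center_comm _ cc) -psc !rmorphM /= -mulrA.
by rewrite st mulr1.
Qed.

(** The graph of psi: q and F have the same numerator p for a common central
    denominator c. *)
Definition fraction_of (q : Q) (F : RMx) : Prop := exists p c : R,
  [/\ center c, c != 0, q * iota c = iota p & F * emb c = emb p].

Lemma emb_center_cancel c (F H : RMx) : center c -> c != 0 ->
  F * emb c = H * emb c -> F = H.
Proof.
move=> cc c0 e; have [C CE] := emb_center_inv cc c0.
have cC : emb c * C = 1 by rewrite (emb_center_comm _ cc).
by rewrite -[F]mulr1 -cC mulrA e -mulrA cC mulr1.
Qed.

Lemma center_mul_neq0 (c d : R) : center c -> c != 0 -> d != 0 -> c * d != 0.
Proof.
move=> cc c0; apply: contra_neq => cd.
by have [H _] := center_regular cc c0 d; apply: H.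
Qed.

(** The equality p c' = p' c of cross products holds in Q, hence in k_n[X],
    hence for rational maps. *)
Lemma fraction_given q F p c : fraction_of q F -> center c ->
  q * iota c = iota p -> F * emb c = emb p.
Proof.
move=> [p' [c' [cc' c'0 qc' Fc']]] cc qc; apply: (emb_center_cancel cc' c'0).
rewrite -mulrA -embM cc embM mulrA Fc' -!embM; congr emb.
have [iI _ _] := Q_frac; apply: iI.
by rewrite !rmorphM /= -qc -qc' -!mulrA -!rmorphM /= cc.
Qed.

Lemma fraction_fun q F H : fraction_of q F -> fraction_of q H -> F = H.
Proof.
move=> fF [p [c [cc c0 qc Hc]]]; apply: (emb_center_cancel cc c0).
by rewrite Hc (fraction_given fF cc qc).
Qed.

Lemma fraction_exists q : exists F, fraction_of q F.
Proof.
have [p [c [cc c0 qc]]] := central_denominator q.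
have [C CE] := emb_center_inv cc c0.
by exists (emb p * C), p, c; split=> //; rewrite -mulrA CE mulr1.
Qed.

Definition psi (q : Q) : RMx := sval (cid (fraction_exists q)).

Lemma psiP q : fraction_of q (psi q).
Proof. exact: (svalP (cid (fraction_exists q))). Qed.

Lemma psi_linear a q1 q2 : psi (a *: q1 + q2) = a *: psi q1 + psi q2.
Proof.
apply: fraction_fun (psiP _) _.
have [p1 [c1 [cc1 n1 q1c F1]]] := psiP q1; have [p2 [c2 [cc2 n2 q2c F2]]] := psiP q2.
exists (a *: (p1 * c2) + p2 * c1), (c1 * c2); split.
- exact: center_mul.
- exact: center_mul_neq0.
- rewrite rmorphD /= linearZ /= !rmorphM /= mulrDl -scalerAl !mulrA q1c.
  by rewrite -(mulrA q2) (iota_center_comm _ cc1) mulrA q2c.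
- rewrite embD embZ !embM mulrDl -scalerAl !mulrA F1.
  by rewrite -(mulrA (psi q2)) (emb_center_comm _ cc1) mulrA F2.
Qed.

Lemma psi_mul q1 q2 : psi (q1 * q2) = psi q1 * psi q2.
Proof.
apply: fraction_fun (psiP _) _.
have [p1 [c1 [cc1 n1 q1c F1]]] := psiP q1; have [p2 [c2 [cc2 n2 q2c F2]]] := psiP q2.
exists (p1 * p2), (c1 * c2); split.
- exact: center_mul.
- exact: center_mul_neq0.
- rewrite !rmorphM /= -q1c -q2c -!mulrA; congr (_ * _).
  by rewrite [RHS](iota_center_comm _ cc1) -!mulrA (iota_center_comm _ cc1) .
- rewrite !embM -F1 -F2 -!mulrA; congr (_ * _).
  by rewrite [RHS](emb_center_comm _ cc1) -!mulrA (emb_center_comm _ cc1).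
Qed.

Lemma psi_one : psi 1 = 1.
Proof.
apply: fraction_fun (psiP _) _; exists 1, 1; split=> //; rewrite ?mul1r //.
- exact: center1.
- exact: oner_neq0.
Qed.

Lemma psi_zmod : zmod_morphism psi.
Proof. by move=> f g; rewrite addrC -scaleN1r psi_linear scaleN1r addrC. Qed.
Lemma psi_scalable : scalable psi.
Proof.
move=> c f; have s0 : psi 0 = 0 by rewrite -(subrr 0) psi_zmod subrr.
by rewrite -[c *: f]addr0 psi_linear s0 addr0.
Qed.
Lemma psi_monoid : monoid_morphism psi.
Proof. by split; [exact: psi_one | exact: psi_mul]. Qed.
HB.instance Definition _ := GRing.isZmodMorphism.Build Q RMx psi psi_zmod.
HB.instance Definition _ := GRing.isScalable.Build k Q RMx _ psi psi_scalable.
HB.instance Definition _ := GRing.isMonoidMorphism.Build Q RMx psi psi_monoid.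

Lemma psi_inj : injective psi.
Proof.
suff ker q : psi q = 0 -> q = 0.
  by move=> q1 q2 e; apply/eqP; rewrite -subr_eq0; apply/eqP/ker; rewrite psi_zmod e subrr.
have [p [c [cc c0 qc Fc]]] := psiP q => q0.
have p0 : p = 0 by apply: emb_inj; rewrite -Fc q0 mul0r emb0.
have [_ /(_ c (center_regular cc c0)) [t [ct _]] _] := Q_frac.
by rewrite -[q]mulr1 -ct mulrA qc p0 rmorph0 mul0r.
Qed.

Lemma psi_surj F : exists q, psi q = F.
Proof.
have [p [c [cc c0 Fc]]] := rational_descent F.
have [_ /(_ c (center_regular cc c0)) [t [ct tc]] _] := Q_frac.
exists (iota p * t); apply: fraction_fun (psiP _) _; exists p, c; split=> //.
by rewrite -mulrA tc mulr1.
Qed.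

Lemma psi_given_by q (p c : R) : center c -> c != 0 -> q * iota c = iota p ->
  given_by (psi q) [set a | crev a c \in unitmx] (fun a => crev a p * invmx (crev a c)).
Proof.
move=> cc c0 qc; have Fc := fraction_given (psiP q) cc qc.
have : generically (fun a => crev a c \in unitmx /\
    rmf (psi q) a = crev a p * invmx (crev a c)).
  apply: gen_mono (gen_and (gen_and (embE p) (embE c))
    (gen_and (rm_funM (psi q) (emb c)) (center_neq0 cc c0))).
  move=> a Xa [[e1 e2] [e3 n0]].
  have cU : crev a c \in unitmx.
    by rewrite (center_scalar cc Xa) unitmxE det_scalar unitrX // unitfE.
  by split=> //; rewrite -e1 -Fc e3 e2 -!mulmxE mulmxK.
by move=> [U dU HU]; exists U => // a /HU.
Qed.

Lemma psi_center : psi @` @center Q = @center RMx.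
Proof.
apply/seteqP; split=> [_ [q cq <-] F|F cF].
  by have [q' <-] := psi_surj F; rewrite -!psi_mul cq.
have [q qF] := psi_surj F; exists q => // q'.
by apply: psi_inj; rewrite !psi_mul qF cF.
Qed.

End FractionRing.

(** A nonzero central x generates the two-sided ideal x A, which contains 1. *)
Lemma center_subfield (A : nzRingType) : simple_ring A -> Defs.subfield (@center A).
Proof.
move=> sA; split.
- exact: center1.
- by move=> x y cx cy a; rewrite mulrBl mulrBr cx cy.
- by move=> x y cx cy; split; [exact: center_mul | rewrite cx].
move=> x cx x0; pose J := [set y : A | exists a, y = x * a].
have [] := sA J.
- by exists 0; rewrite mulr0.
- by move=> _ _ [a ->] [b ->]; exists (a + b); rewrite mulrDr.
- move=> a _ [b ->]; split; last by exists (b * a); rewrite mulrA.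
  by exists (a * b); rewrite !mulrA cx.
- move=> J0; have : J x by exists 1; rewrite mulr1.
  by rewrite J0 => /eqP; rewrite (negPf x0).
move=> J1; have [y xy] : J 1 by rewrite J1.
exists y => // a.
by rewrite -[LHS]mulr1 xy mulrA -(mulrA y) -cx mulrA -cx -xy mul1r.
Qed.

Lemma purely_inseparable_refl (A : nzRingType) (K : set A) :
  Defs.subfield K -> finite_purely_inseparable K K.
Proof.
move=> sK; have [K1 _ _ _] := sK; split=> //.
- exists 1%N, (fun=> 1); split=> // x Kx; exists (fun=> x).
  by split=> //; rewrite big_ord1 mulr1.
- by move=> x Kx; exists 1%N.
Qed.

Theorem mainTheorem4 (k : closedFieldType) (m n : nat) (X : irrNVariety k m n)
    (Q : algType k) (iota : {lrmorphism coordRing X -> Q})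
    (Q_frac : total_ring_of_fractions iota) :
  exists (psi : {lrmorphism Q -> RMapsMx X})
         (sigma : {lrmorphism invRatFun X -> RMapsMx X}),
  [/\ injective psi /\
      (forall (q : Q) (p c : coordRing X),
         center c -> c != 0 -> q * iota c = iota p ->
         given_by (psi q) [set a | cr_eval a c \in unitmx]
           (fun a => cr_eval a p * invmx (cr_eval a c))),
      injective sigma /\
      (forall f : invRatFun X,
         given_by (sigma f) setT (fun a => (rm_fun f a)%:M)),
      central_simple_of_degree n.+1 (RMapsMx X) /\
      range sigma = @center (RMapsMx X),
      finite_purely_inseparable (psi @` @center Q) (range sigma)
    & forall F : RMapsMx X, exists (r : nat) (q : 'I_r -> Q)
        (f : 'I_r -> invRatFun X), F = \sum_i psi (q i) * sigma (f i)].
Proof.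
exists (psi Q_frac), (@sigma k m n X); split.
- by split; [exact: psi_inj | exact: psi_given_by].
- split; first exact: sigma_inj.
  by move=> f; have [U dU HU] := sigmaE f; exists U => // a /HU.
- by split; [exact: RMaps_central_simple | exact: range_sigma].
- rewrite /= psi_center range_sigma; apply: purely_inseparable_refl.
  by apply: center_subfield; apply: RMaps_simple.
- move=> F; have [q qF] := psi_surj Q_frac F.
  exists 1%N, (fun=> q), (fun=> 1).
  by rewrite big_ord1 rmorph1 mulr1.
Qed.
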